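(* Let $c:\mathbb{R}^d\to\{-1,+1\}$ be any binary classifier and let $\mathcal{D}$ be a probability distribution over $\mathbb{R}^d$ whose one-dimensional marginals all have continuous cumulative distribution functions. If there exists an efficient algorithm for learning $\mathcal{H}_\mu^{\mathcal{D}}$ (for $\mu\in(0,1)$ given) in the agnostic model on distribution $\mathcal{D}$, then there is an efficient auditing algorithm for $c$ on the subgroups represented by $\mathcal{H}^d$ over the distribution $\mathcal{D}$.
   Context: Notation. $\mathcal{H}^d$ is the class of all halfspaces on $\mathbb{R}^d$, viewed as functions $h:\mathbb{R}^d\to\{-1,+1\}$, $h(x)=\mathrm{sgn}(w^\top x-t)$ with $w\neq 0$, $t\in\mathbb{R}$; the subgroup represented by $h$ is $\{x: h(x)=1\}$. A one-dimensional marginal of $\mathcal{D}$ is the law of $w^\top x$, $x\sim\mathcal{D}$, for some $w\ne 0$. For $\mu\in(0,1)$, $\mathcal{H}_\mu^{\mathcal{D}}=\{h\in\mathcal{H}^d : \Pr_{x\sim\mathcal{D}}\{h(x)=1\}=\mu\}$. For a subgroup $h$ of positive probability, $d_{\mathcal{D}}(c,h)=\Pr_{x\sim\mathcal{D}}\{c(x)=1\}-\Pr_{x\sim\mathcal{D}}\{c(x)=1\mid h(x)=1\}$, and its (statistical parity) unfairness is $\Pr_{x\sim\mathcal{D}}\{h(x)=1\}\,|d_{\mathcal{D}}(c,h)|$. Efficient agnostic learning of $\mathcal{H}_\mu^{\mathcal{D}}$ on $\mathcal{D}$: an algorithm that, given $\mu$, $\epsilon,\delta\in(0,1)$ and i.i.d.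 labeled examples $(x,f(x))$ with $x\sim\mathcal{D}$, where $f:\mathbb{R}^d\to\{-1,+1\}$ is an arbitrary binary labeling, runs in time $\mathrm{poly}(d,1/\epsilon,\log(1/\delta))$ and with probability at least $1-\delta$ outputs $\hat h\in\mathcal{H}_\mu^{\mathcal{D}}$ with $\Pr_{x\sim\mathcal{D}}\{\hat h(x)\ne f(x)\}\le\inf_{h\in\mathcal{H}_\mu^{\mathcal{D}}}\Pr_{x\sim\mathcal{D}}\{h(x)\neq f(x)\}+\epsilon$. Efficient auditing of $c$ on $\mathcal{H}^d$ over $\mathcal{D}$ (restricted to statistically significant subgroups): an algorithm that, given constants $0<a\le b<1$, $\epsilon,\delta\in(0,1)$ and i.i.d. samples $(x,c(x))$, $x\sim\mathcal{D}$, runs in time $\mathrm{poly}(d,1/\epsilon,\log(1/\delta))$ and with probability at least $1-\delta$ outputs $h'\in\mathcal{H}^d$ with $a\le\Pr_{x\sim\mathcal{D}}\{h'(x)=1\}\le b$ and $$\Pr\{h'(x)=1\}\,|d_{\mathcal{D}}(c,h')|\ \ge\ \sup\bigl\{\Pr\{h(x)=1\}\,|d_{\mathcal{D}}(c,h)| : h\in\mathcal{H}^d,\ a\le\Pr\{h(x)=1\}\le b\bigr\}-\epsilon .$$ *)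

(* Defs.v *)
From HB Require Import structures.
From mathcomp Require Export all_boot all_order all_algebra.
From mathcomp Require Export all_classical all_reals all_analysis.
From mathcomp Require Export measurable_realfun.

Set Implicit Arguments.
Unset Strict Implicit.
Unset Printing Implicit Defensive.

Import Order.TTheory GRing.Theory Num.Theory.
Import numFieldNormedType.Exports.

Local Open Scope classical_set_scope.
Local Open Scope ring_scope.

(** * Real-number computation with a step count

    The machine model is a real RAM in functional form: programs transform
    binary trees (S-expressions) whose leaves are real numbers or [Nil].
    Arithmetic and comparison of reals are exact and cost one step. A program
    is a finite syntactic object that sees its input only through the
    operations below, so a single program has to work uniformly for all inputs.
    Arrays are represented by lists, which is at most polynomially slower than
    random access. *)

(** Operations available at unit cost besides +, -, *, / and <=. The family may
    be empty; it may also contain constants, roots, exponentials, quantile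
    functions and so on, which matters because a halfspace with a prescribed
    probability usually has a transcendental threshold. *)
Record primitives (R : realType) := Primitives {
  prim_name : Type;
  prim_fun : prim_name -> seq R -> R;
  prim_measurable : forall k n,
    measurable_fun [set: n.-tuple R] (fun x : n.-tuple R => prim_fun k x) }.

Inductive tree (R : Type) := Nil | Num of R | Cons of tree R & tree R.
Arguments Nil {R}.

Inductive arith := Add | Sub | Mul | Div.

Inductive prog (R : realType) (B : primitives R) :=
| PId | PNil | POne | PHead | PTail
| PCons of prog B & prog B
| PSeq of prog B & prog B
| PArith of arith & prog B & prog B
| PLeq of prog B & prog B
| PPrim of prim_name B & prog B
| PIf of prog B & prog B & prog B
| PWhile of prog B & prog B.
Arguments PId {R B}.
Arguments PNil {R B}.
Arguments POne {R B}.
Arguments PHead {R B}.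
Arguments PTail {R B}.

Section Semantics.
Context (R : realType) (B : primitives R).
Implicit Types (p q r : prog B) (u v w : tree R).

Definition head v := if v is Cons u _ then u else Nil.
Definition tail v := if v is Cons _ u then u else Nil.
Definition num v : R := if v is Num x then x else 0.
(* [Nil] is the only false value. *)
Definition truth v := if v is Nil then false else true.
Definition of_bool (b : bool) : tree R := if b then Cons Nil Nil else Nil.
Definition of_seq : seq (tree R) -> tree R := foldr (@Cons R) Nil.
(* The maximal prefix of the list [v] that consists of numbers. *)
Fixpoint nums v : seq R := if v is Cons (Num x) u then x :: nums u else [::].

Definition arith_fun (o : arith) : R -> R -> R :=
  match o with
  | Add => fun x y => x + y
  | Sub => fun x y => x - y
  | Mul => fun x y => x * y
  | Div => fun x y => x / y
  end.

(** [run p v t u]: on input [v], program [p] halts after exactly [t] steps with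
    output [u]. *)
Inductive run : prog B -> tree R -> nat -> tree R -> Prop :=
| RunId v : run PId v 1 v
| RunNil v : run PNil v 1 Nil
| RunOne v : run POne v 1 (Num 1)
| RunHead v : run PHead v 1 (head v)
| RunTail v : run PTail v 1 (tail v)
| RunCons p q v s t u w :
    run p v s u -> run q v t w -> run (PCons p q) v (s + t).+1 (Cons u w)
| RunSeq p q v s t u w :
    run p v s u -> run q u t w -> run (PSeq p q) v (s + t).+1 w
| RunArith o p q v s t u w :
    run p v s u -> run q v t w ->
    run (PArith o p q) v (s + t).+1 (Num (arith_fun o (num u) (num w)))
| RunLeq p q v s t u w :
    run p v s u -> run q v t w ->
    run (PLeq p q) v (s + t).+1 (of_bool (num u <= num w))
| RunPrim k p v s u :
    run p v s u ->
    run (PPrim k p) v (s + size (nums u)).+1 (Num (prim_fun k (nums u)))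
| RunIf p q r v s t u w :
    run p v s u -> run (if truth u then q else r) v t w ->
    run (PIf p q r) v (s + t).+1 w
| RunWhileStop p q v s u :
    run p v s u -> ~~ truth u -> run (PWhile p q) v s.+1 v
| RunWhileStep p q v s t t' u v' w :
    run p v s u -> truth u -> run q v t v' -> run (PWhile p q) v' t' w ->
    run (PWhile p q) v (s + t + t').+1 w.

End Semantics.

(** * Halfspaces and probabilities

    R^n is [n.-tuple R] with the product sigma-algebra, and the label set
    {-1, +1} is [bool], with [true] for +1. *)

Section Halfspaces.
Context (R : realType) (n : nat).
Implicit Types (w x : n.-tuple R) (c h : n.-tuple R -> bool).

Definition dot w x : R := \sum_(j < n) tnth w j * tnth x j.

Lemma measurable_dot w : measurable_fun [set: n.-tuple R] (dot w).
Proof.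
apply: measurable_sum => j; apply: measurable_funM => //.
exact: measurable_tnth.
Qed.

HB.instance Definition _ w :=
  isMeasurableFun.Build _ _ _ _ (dot w) (measurable_dot w).

(* The convention is sgn 0 = +1. *)
Definition halfspace w (t : R) : n.-tuple R -> bool := fun x => 0 <= dot w x - t.

Definition nonzero w := exists j, tnth w j != 0.

Definition halfspaces : set (n.-tuple R -> bool) :=
  [set h | exists w t, nonzero w /\ h = halfspace w t].

Definition continuous_marginals (D : probability (n.-tuple R) R) :=
  forall w, nonzero w -> continuous (cdf (dot w : {RV D >-> R})).

Section Distribution.
Variable D : probability (n.-tuple R) R.

Definition pr (A : set (n.-tuple R)) : R := fine (D A).
Definition condpr (A B : set (n.-tuple R)) : R := pr (A `&` B) / pr B.

Definition halfspaces_of_mass (mu : R) : set (n.-tuple R -> bool) :=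
  [set h | halfspaces h /\ pr [set x | h x] = mu].

Definition error h f : R := pr [set x | h x != f x].

Definition disparity c h : R :=
  pr [set x | c x] - condpr [set x | c x] [set x | h x].
Definition unfairness c h : R := pr [set x | h x] * `|disparity c h|.

Definition significant (a b : R) : set (n.-tuple R -> bool) :=
  [set h | halfspaces h /\ a <= pr [set x | h x] <= b].

End Distribution.

Definition of_vec w : tree R := of_seq (map (@Num R) w).
Definition of_label (b : bool) : tree R := Num (if b then 1 else -1).

Definition labeled_sample m (s : m.-tuple (n.-tuple R)) c : tree R :=
  of_seq [seq Cons (of_vec x) (of_label (c x)) | x <- s].

Definition of_halfspace w (t : R) : tree R := Cons (of_vec w) (Num t).

End Halfspaces.

(** * I.i.d. samples *)

Section Iid.
Context d (T : measurableType d) (R : realType).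

Definition consT m (z : T * m.-tuple T) : m.+1.-tuple T := [tuple of z.1 :: z.2].

Lemma measurable_consT m : measurable_fun [set: T * m.-tuple T] (@consT m).
Proof. exact: measurable_cons. Qed.

HB.instance Definition _ m :=
  isMeasurableFun.Build _ _ _ _ (@consT m) (@measurable_consT m).

(** The law of [m] independent draws from [D]. *)
Fixpoint iid (D : probability T R) (m : nat) : probability (m.-tuple T) R :=
  if m is m'.+1 then distribution (D \x iid D m')%E (@consT m')
  else dirac [tuple].

(* [E] occurs with probability at least [r]; it is not assumed a priori that [E]
   is measurable. *)
Definition prob_at_least (P : probability T R) (E : set T) (r : R) :=
  exists F : set T, [/\ measurable F, F `<=` E & (r%:E <= P F)%E].

End Iid.

(** * Efficient learning and auditing

    A running time poly(n, 1/eps, log(1/delta)) is an asymptotic notion, so it is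
    stated for a family of distributions [D i] on R^(n i), with one program and
    one polynomial for the whole family. Any index type is allowed: with
    [unit] the family is one distribution, with [nat] and [n i = i] it is one
    distribution for each dimension.

    A program receives its parameters and a list of labeled examples. The list
    may be of any length from the time budget upwards, and a program cannot look
    at more examples than it has steps: the list acts as an example oracle.
    Private coin tosses are not needed: when marginals are continuous, comparing
    the first coordinates of two fresh examples is a fair coin toss. *)

Section Efficient.
Context (R : realType) (B : primitives R) (I : Type) (n : I -> nat).
Implicit Types (D : forall i, probability ((n i).-tuple R) R) (p : prog B).

(* As [eps^-1 > 1], every polynomial in the three quantities is bounded by one of
   this form. *)
Definition budget (C k d : nat) (eps delta : R) : R :=
  C%:R * (d%:R + eps^-1 + ln delta^-1) ^+ k.

Definition halts_within p (v : tree R) (T : R) :=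
  exists t u, run p v t u /\ t%:R <= T.

Definition outputs p (v : tree R) d (H : set (d.-tuple R -> bool)) :=
  exists t w theta, run p v t (of_halfspace w theta) /\ H (halfspace w theta).

Definition learner_input i (mu eps delta : R) m
    (s : m.-tuple ((n i).-tuple R)) f : tree R :=
  of_seq [:: Num (n i)%:R; Num mu; Num eps; Num delta; labeled_sample s f].

(** [p] agnostically learns, for every given mass [mu], the halfspaces of mass
    [mu] under [D i]. *)
Definition efficient_agnostic_learner D p :=
  exists C k : nat,
  forall (i : I) (mu eps delta : R) (f : (n i).-tuple R -> bool) (m : nat),
    0 < mu < 1 -> 0 < eps < 1 -> 0 < delta < 1 ->
    measurable_fun [set: (n i).-tuple R] f ->
    budget C k (n i) eps delta <= m%:R ->
    let input := fun s : m.-tuple ((n i).-tuple R) =>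
      learner_input mu eps delta s f in
    let opt := inf [set error (D i) h f | h in halfspaces_of_mass (D i) mu] in
    (forall s, halts_within p (input s) (budget C k (n i) eps delta)) /\
    prob_at_least (iid (D i) m)
      [set s | outputs p (input s)
        [set h | halfspaces_of_mass (D i) mu h /\ error (D i) h f <= opt + eps]]
      (1 - delta).

Definition auditor_input i (a b eps delta : R) m
    (s : m.-tuple ((n i).-tuple R)) c : tree R :=
  of_seq
    [:: Num (n i)%:R; Num a; Num b; Num eps; Num delta; labeled_sample s c].

(** [p] audits the classifiers [c i] on the halfspaces over [D i]. *)
Definition efficient_auditor D (c : forall i, (n i).-tuple R -> bool) p :=
  exists C k : nat,
  forall (i : I) (a b eps delta : R) (m : nat),
    0 < a -> a <= b -> b < 1 -> 0 < eps < 1 -> 0 < delta < 1 ->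
    budget C k (n i) eps delta <= m%:R ->
    let input := fun s : m.-tuple ((n i).-tuple R) =>
      auditor_input a b eps delta s (c i) in
    let worst :=
      sup [set unfairness (D i) (c i) h | h in significant (D i) a b] in
    (forall s, halts_within p (input s) (budget C k (n i) eps delta)) /\
    prob_at_least (iid (D i) m)
      [set s | outputs p (input s)
        [set h | significant (D i) a b h /\
                 worst - eps <= unfairness (D i) (c i) h]]
      (1 - delta).

End Efficient.

(* Main.v *)
(** For a halfspace h of mass mu put gap(h) = P(c and h) - mu P(c). The
    unfairness of h is |gap(h)|, and 2 gap(h) differs from minus the error of h
    with respect to c by a constant that depends on mu only. So learning at mass
    mu maximizes gap, and learning at mass 1 - mu and passing to the complement
    minimizes it. Moving the threshold changes gap by at most the change of
    mass, and continuity of the marginals lets every smaller mass be reached;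
    hence it is enough to try the masses a, a + e, a + 2e, ... up to b, with
    e = eps/4. The best candidate is chosen on a separate test sample by a
    Chernoff bound, so its length is polynomial in log(1/delta); the machine has
    no logarithm and finds the length by multiplying 1 + e^2/32 repeatedly.

    The Chernoff bound is applied for a fixed training sample and integrated
    over all of them, which needs the candidates to depend measurably on the
    training sample. This holds because programs compute measurable functions. *)

Require Import Defs.
From mathcomp Require Import zify ring lra.

Set Implicit Arguments.
Unset Strict Implicit.
Unset Printing Implicit Defensive.

Import Order.TTheory GRing.Theory Num.Theory.
Import numFieldNormedType.Exports.

Local Open Scope classical_set_scope.
Local Open Scope ring_scope.

(** * Running times and truncated evaluation *)

Section RunsIn.
Context (R : realType) (B : primitives R).
Implicit Types (p q r : prog B) (u v w : tree R).

(** A candidate for the mass mu has mass exactly mu, so its gap is the mean of a statistic that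
    vanishes on negative examples and is [1 - mu] or [- mu] on positive ones, according to whether
    the point lies in the halfspace. Neither P(c) nor the mass of the candidate has to be estimated.
    The learner is correct only with high probability, but its step bound holds on every sample.
    Evaluation with all loops cut off at that bound therefore agrees with the learner everywhere,
    and it is total and measurable. On a bad sample the output may be any tree, so programs that
    handle a candidate are clocked by a list of known length, and decoding a tree into a halfspace
    is total. Test examples are taken from the front of the list, where the recursion of [iid] adds
    draws; they can then be integrated out one at a time while the training sample stays fixed. *)

Definition runs_in p v (T : nat) u := exists2 t, run p v t u & (t <= T)%N.

Lemma runs_inW p v s t u : runs_in p v s u -> (s <= t)%N -> runs_in p v t u.
Proof. by case=> s' rs' /leq_trans le_s' /le_s'; exists s'. Qed.

Lemma run_runs_in p v t u : run p v t u -> runs_in p v t u.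
Proof. by exists t. Qed.

Lemma runs_id v : runs_in PId v 1 v.
Proof. exact/run_runs_in/RunId. Qed.

Lemma runs_nil v : runs_in PNil v 1 Nil.
Proof. exact/run_runs_in/RunNil. Qed.

Lemma runs_one v : runs_in POne v 1 (Num 1).
Proof. exact/run_runs_in/RunOne. Qed.

Lemma runs_head v : runs_in PHead v 1 (head v).
Proof. exact/run_runs_in/RunHead. Qed.

Lemma runs_tail v : runs_in PTail v 1 (tail v).
Proof. exact/run_runs_in/RunTail. Qed.

Lemma runs_cons p q v s t u w :
  runs_in p v s u -> runs_in q v t w ->
  runs_in (PCons p q) v (s + t).+1 (Cons u w).
Proof.
case=> s' rp les [t' rq let'].
by exists (s' + t').+1; [exact: RunCons | rewrite ltnS leq_add].
Qed.

Lemma runs_seq p q v s t u w :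
  runs_in p v s u -> runs_in q u t w -> runs_in (PSeq p q) v (s + t).+1 w.
Proof.
case=> s' rp les [t' rq let'].
by exists (s' + t').+1; [exact: RunSeq rp rq | rewrite ltnS leq_add].
Qed.

Lemma runs_arith o p q v s t u w :
  runs_in p v s u -> runs_in q v t w ->
  runs_in (PArith o p q) v (s + t).+1 (Num (arith_fun o (num u) (num w))).
Proof.
case=> s' rp les [t' rq let'].
by exists (s' + t').+1; [exact: RunArith | rewrite ltnS leq_add].
Qed.

Lemma runs_leq p q v s t u w :
  runs_in p v s u -> runs_in q v t w ->
  runs_in (PLeq p q) v (s + t).+1 (of_bool R (num u <= num w)).
Proof.
case=> s' rp les [t' rq let'].
by exists (s' + t').+1; [exact: RunLeq | rewrite ltnS leq_add].
Qed.

Lemma runs_if p q r v s t u w :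
  runs_in p v s u -> runs_in (if truth u then q else r) v t w ->
  runs_in (PIf p q r) v (s + t).+1 w.
Proof.
case=> s' rp les [t' rq let'].
by exists (s' + t').+1; [exact: RunIf rp rq | rewrite ltnS leq_add].
Qed.

(** The bound consists of [n] rounds of cost [(g + s).+1] and one last, failing test of cost
    [g.+1]. *)
Lemma runs_while (inv : nat -> tree R -> Prop) n g s p q v :
  (forall j v, (j < n)%N -> inv j v ->
     (exists2 u, runs_in p v g u & truth u) /\
     (exists2 v', runs_in q v s v' & inv j.+1 v')) ->
  (forall v, inv n v -> exists2 u, runs_in p v g u & ~~ truth u) ->
  inv 0%N v ->
  exists2 v', runs_in (PWhile p q) v (n * (g + s).+1 + g.+1) v' & inv n v'.
Proof.
move=> step stop inv0.
suff: forall k j v, (k + j = n)%N -> inv j v ->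
    exists2 v', runs_in (PWhile p q) v (k * (g + s).+1 + g.+1) v' & inv n v'.
  by move=> /(_ n 0%N v (addn0 n)); exact.
elim=> [|k IHk] j v1 jn invj.
  rewrite add0n in jn; rewrite jn in invj.
  have [u [t rt let'] ntu] := stop _ invj.
  by exists v1 => //; exists t.+1; [exact: RunWhileStop rt ntu | lia].
have ltj : (j < n)%N by lia.
have [[u [t rt let'] tu] [v' [t' rt' let''] inv']] := step _ _ ltj invj.
have kj : (k + j.+1 = n)%N by lia.
have [w [t'' rt'' let3] invw] := IHk _ _ kj inv'.
exists w => //; exists (t + t' + t'').+1; first exact: RunWhileStep rt tu rt' rt''.
lia.
Qed.

(** Cutting every loop off after [N] rounds makes evaluation total, so that it
    makes sense to ask whether the output is a measurable function of the input. *)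
Fixpoint eval (N : nat) p v : tree R :=
  match p with
  | PId => v
  | PNil => Nil
  | POne => Num 1
  | PHead => head v
  | PTail => tail v
  | PCons p q => Cons (eval N p v) (eval N q v)
  | PSeq p q => eval N q (eval N p v)
  | PArith o p q => Num (arith_fun o (num (eval N p v)) (num (eval N q v)))
  | PLeq p q => of_bool R (num (eval N p v) <= num (eval N q v))
  | PPrim k p => Num (prim_fun k (nums (eval N p v)))
  | PIf p q r => if truth (eval N p v) then eval N q v else eval N r v
  | PWhile p q => iter N (fun v => if truth (eval N p v) then eval N q v else v) v
  end.

(** Unrolling a loop uses up one round, so the induction hypothesis for loops has to cover every
    number of rounds [m >= t] and not only the cut-off [N]. Extra rounds do no harm: a state at
    which the guard fails is a fixed point of the iterated body. *)
Lemma eval_run N p v t u : run p v t u -> (t <= N)%N -> eval N p v = u.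
Proof.
move=> rt.
suff: (t <= N)%N -> eval N p v = u /\
    forall q1 q2, p = PWhile q1 q2 -> forall m, (t <= m)%N ->
    iter m (fun v => if truth (eval N q1 v) then eval N q2 v else v) v = u.
  by move=> H /H[].
elim: p v t u / rt => //=.
- move=> p q v s t u w _ IHp _ IHq le.
  by rewrite (IHp _).1 ?(IHq _).1 //; lia.
- move=> p q v s t u w _ IHp _ IHq le.
  by rewrite (IHp _).1 ?(IHq _).1 //; lia.
- move=> o p q v s t u w _ IHp _ IHq le.
  by rewrite (IHp _).1 ?(IHq _).1 //; lia.
- move=> p q v s t u w _ IHp _ IHq le.
  by rewrite (IHp _).1 ?(IHq _).1 //; lia.
- move=> k p v s u _ IHp le.
  by rewrite (IHp _).1 //; lia.
- move=> p q r v s t u w _ IHp _ IHq le; split=> //.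
  rewrite (IHp _).1; last lia.
  by case: ifP IHq => _ IHq; rewrite (IHq _).1 //; lia.
- move=> p q v s u _ IHp ntu le.
  have fixv m : iter m (fun v0 => if truth (eval N p v0) then eval N q v0 else v0) v = v.
    elim: m => //= m ->; rewrite (IHp _).1; last lia.
    by rewrite (negbTE ntu).
  by split=> // q1 q2 [<- <-] m _; exact: fixv.
- move=> p q v s t t' u v' w _ IHp tu _ IHq _ IHw le.
  have stepv : (if truth (eval N p v) then eval N q v else v) = v'.
    by rewrite (IHp _).1 ?tu ?(IHq _).1 //; lia.
  have H m : (s + t + t' < m)%N ->
      iter m (fun v0 => if truth (eval N p v0) then eval N q v0 else v0) v = w.
    case: m => // m ltm; rewrite iterSr stepv.
    by apply: (IHw _).2 => //; lia.
  split; first exact: H.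
  by move=> q1 q2 [<- <-] m; exact: H.
Qed.

End RunsIn.

(** * List programs *)

Section Programs.
Context (R : realType) (B : primitives R).
Implicit Types (p q r : prog B) (u v w h : tree R).

Lemma runs_conv p v s t u u' :
  runs_in p v s u -> (s <= t)%N -> u = u' -> runs_in p v t u'.
Proof. by move=> rp le <-; exact: runs_inW rp le. Qed.

Lemma runs_while_stop p q v s u :
  runs_in p v s u -> ~~ truth u -> runs_in (PWhile p q) v s.+1 v.
Proof. by case=> t rp le ntu; exists t.+1 => //; exact: RunWhileStop rp ntu. Qed.

Lemma runs_while_step p q v s t t' u v' w :
  runs_in p v s u -> truth u -> runs_in q v t v' ->
  runs_in (PWhile p q) v' t' w -> runs_in (PWhile p q) v (s + t + t').+1 w.
Proof.
case=> s1 rp les tu [t1 rq let1] [t2 rw let2].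
by exists (s1 + t1 + t2).+1; [exact: RunWhileStep rp tu rq rw | lia].
Qed.

Fixpoint pnat k : prog B :=
  if k is k'.+1 then PArith Add POne (pnat k') else PArith Sub POne POne.

Lemma runs_pnat k v : runs_in (pnat k) v (2 * k + 3)%N (Num k%:R).
Proof.
elim: k => [|k IHk].
  apply: runs_conv; first exact: runs_arith (runs_one _ _) (runs_one _ _).
    by [].
  by rewrite /= subrr.
apply: runs_conv; first exact: runs_arith (runs_one _ _) IHk.
  by lia.
by rewrite /= nat1r.
Qed.

Fixpoint ptails i : prog B := if i is i'.+1 then PSeq PTail (ptails i') else PId.
Definition pat i : prog B := PSeq (ptails i) PHead.

Lemma runs_ptails i v : runs_in (ptails i) v (2 * i + 1)%N (iter i (@tail R) v).
Proof.
elim: i v => [|i IHi] v; first exact: runs_id.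
apply: runs_conv; first exact: runs_seq (runs_tail _ _) (IHi _).
  by lia.
by rewrite -iterSr.
Qed.

Lemma runs_pat i v : runs_in (pat i) v (2 * i + 3)%N (head (iter i (@tail R) v)).
Proof.
apply: runs_conv; first exact: runs_seq (runs_ptails _ _) (runs_head _ _).
  by lia.
by [].
Qed.

Definition plist : seq (prog B) -> prog B := foldr (@PCons R B) PNil.

Definition num_list (xs : seq R) : tree R := of_seq (map (@Num R) xs).

End Programs.

Ltac runs := repeat first
  [ eapply runs_pnat | eapply runs_pat | eapply runs_ptails | eapply runs_id
  | eapply runs_nil | eapply runs_one | eapply runs_head | eapply runs_tail
  | eapply runs_cons | eapply runs_seq | eapply runs_arith | eapply runs_leq ].

(** * Programs that evaluate, score and complement halfspaces *)

Section Halfspace.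
Context (R : realType) (B : primitives R).
Implicit Types (p q r : prog B) (u v w h : tree R).

(** The loop state is [(acc, w, xs)]. Only [xs] is tested, so the number of rounds does not depend
    on the tree [w], whose missing coordinates are read as 0. *)
Definition pdot : prog B :=
  PWhile (PSeq PTail PTail)
    (PCons (PArith Add PHead
              (PArith Mul (PSeq PTail (PSeq PHead PHead)) (PSeq PTail (PSeq PTail PHead))))
           (PCons (PSeq PTail (PSeq PHead PTail)) (PSeq PTail (PSeq PTail PTail)))).

Fixpoint dot_tree acc w (xs : seq R) :=
  if xs is x :: xs' then dot_tree (acc + num (head w) * x) (tail w) xs' else acc.

Lemma runs_pdot acc w xs : exists w',
  runs_in pdot (Cons (Num acc) (Cons w (num_list xs))) (50 * size xs + 10)
    (Cons (Num (dot_tree acc w xs)) w').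
Proof.
elim: xs acc w => [|x xs IHxs] acc w.
  exists (Cons w Nil); apply: runs_conv; first apply: runs_while_stop.
  - by runs.
  - by [].
  - by [].
  - by [].
have [w' IH] := IHxs (acc + num (head w) * x) (tail w).
exists w'; apply: runs_conv.
- apply: runs_while_step; [by runs | by [] | by runs | exact: IH].
- by rewrite /=; lia.
- by [].
Qed.

Definition phalfspace : prog B :=
  PLeq (pnat B 0)
    (PSeq (PSeq (PCons (PArith Sub (pnat B 0) (PSeq PHead PTail))
                       (PCons (PSeq PHead PHead) PTail)) pdot) PHead).

Definition halfspace_tree h xs := 0 <= dot_tree (- num (tail h)) (head h) xs.

Lemma runs_phalfspace h xs :
  runs_in phalfspace (Cons h (num_list xs)) (50 * size xs + 50)
    (of_bool R (halfspace_tree h xs)).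
Proof.
have [w' rd] := runs_pdot (- num (tail h)) (head h) xs.
apply: runs_conv.
- apply: runs_leq; first by runs.
  apply: runs_seq; last exact: runs_head.
  apply: runs_seq; last exact: rd.
  by apply: runs_conv; [runs|exact: leqnn|rewrite /= sub0r].
- by rewrite /=; lia.
- by [].
Qed.

Definition example (xb : seq R * bool) : tree R :=
  Cons (num_list xb.1) (of_label R xb.2).

Definition score_step h (mu : R) acc (xb : seq R * bool) :=
  if xb.2 then acc + ((if halfspace_tree h xb.1 then 1 else 0) - mu) else acc.

(** The loop state is [(acc, h, mu, examples)]; [ex] is the current example, whose label 1 or -1 is
    tested by comparison with 0. *)
Definition pscore_loop : prog B :=
  let ex := PSeq PTail (PSeq PTail (PSeq PTail PHead)) in
  PWhile (PSeq PTail (PSeq PTail PTail))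
    (PCons (PIf (PLeq (pnat B 0) (PSeq ex PTail))
              (PArith Add PHead (PArith Sub
                 (PIf (PSeq (PCons (PSeq PTail PHead) (PSeq ex PHead)) phalfspace)
                    POne (pnat B 0))
                 (PSeq PTail (PSeq PTail PHead))))
              PHead)
       (PCons (PSeq PTail PHead)
          (PCons (PSeq PTail (PSeq PTail PHead))
             (PSeq PTail (PSeq PTail (PSeq PTail PTail)))))).

Lemma runs_pscore_loop n h mu acc (ts : seq (seq R * bool)) :
  all (fun xb => size xb.1 == n) ts -> exists w',
  runs_in pscore_loop
    (Cons (Num acc) (Cons h (Cons (Num mu) (of_seq (map example ts)))))
    (size ts * (50 * n + 200) + 20)
    (Cons (Num (foldl (score_step h mu) acc ts)) w').
Proof.
elim: ts acc => [|[xs b] ts IHts] acc.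
  move=> _; exists (Cons h (Cons (Num mu) Nil)).
  apply: runs_conv; first apply: runs_while_stop.
  - by runs.
  - by [].
  - by [].
  - by [].
move=> /= /andP[/eqP sz allts].
have [w' IH] := IHts (score_step h mu acc (xs, b)) allts.
have rh : runs_in (PSeq (PCons (PSeq PTail PHead)
      (PSeq (PSeq PTail (PSeq PTail (PSeq PTail PHead))) PHead)) phalfspace)
      (Cons (Num acc) (Cons h (Cons (Num mu)
         (Cons (example (xs, b)) (of_seq (map example ts))))))
      (50 * n + 70) (of_bool R (halfspace_tree h xs)).
  apply: runs_conv.
  - by apply: runs_seq; [runs | exact: runs_phalfspace].
  - by rewrite /= sz; lia.
  - by [].
have rif : runs_in (PIf (PSeq (PCons (PSeq PTail PHead)
      (PSeq (PSeq PTail (PSeq PTail (PSeq PTail PHead))) PHead)) phalfspace)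
      POne (pnat B 0))
      (Cons (Num acc) (Cons h (Cons (Num mu)
         (Cons (example (xs, b)) (of_seq (map example ts))))))
      (50 * n + 75) (Num (if halfspace_tree h xs then 1 else 0)).
  apply: runs_conv; [apply: (runs_if (t := 4%N)); first exact: rh | lia | reflexivity].
  case: (halfspace_tree h xs) => /=; first exact: runs_inW (runs_one _ _) _.
  exact: runs_inW (runs_pnat _ 0 _) _.
exists w'; apply: runs_conv.
- apply: runs_while_step; [by runs | by [] | apply: runs_cons; last by runs | exact: IH].
  apply: (@runs_conv _ _ _ _ (50 * n + 150)%N); [|exact: leqnn|reflexivity].
  apply: runs_conv; [apply: (runs_if (t := (50 * n + 100)%N)); first by runs
    | rewrite /=; lia | reflexivity].
  rewrite /score_step /=; case: b {IH} rh rif => rh rif /=.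
    rewrite ler01 /=; apply: runs_conv.
    - apply: runs_arith; first exact: runs_head.
      by apply: runs_arith; [exact: rif | runs].
    - by rewrite /=; lia.
    - by [].
  have -> : 0 <= -1 :> R = false by apply/negbTE; rewrite -ltNge ltrN10.
  by apply: runs_conv; [exact: runs_head | lia | reflexivity].
- by rewrite /=; lia.
- by [].
Qed.

Definition pscore : prog B :=
  PSeq (PSeq (PSeq (PCons (pnat B 0) PId) pscore_loop) PHead)
    (PIf (PLeq (pnat B 0) PId) PId (PArith Sub (pnat B 0) PId)).

Definition score h mu (ts : seq (seq R * bool)) : R :=
  foldl (score_step h mu) 0 ts.

Lemma runs_pscore n h mu (ts : seq (seq R * bool)) :
  all (fun xb => size xb.1 == n) ts ->
  runs_in pscore (Cons h (Cons (Num mu) (of_seq (map example ts))))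
    (size ts * (50 * n + 200) + 60) (Num `|score h mu ts|).
Proof.
move=> allts; have [w' rl] := runs_pscore_loop h mu 0 allts.
apply: runs_conv.
- apply: runs_seq.
    by apply: runs_seq; [apply: runs_seq; [by runs | exact: rl] | exact: runs_head].
  apply: (runs_if (t := 20%N) (w := Num `|score h mu ts|)); first by runs.
  rewrite /= -/(score h mu ts); have [ge0|lt0] := lerP 0 (score h mu ts).
    rewrite ger0_norm //=; exact: runs_inW (runs_id _ _) _.
  rewrite ltr0_norm //=.
  by apply: runs_conv; [runs | | rewrite /= subrr sub0r].
- by rewrite /=; lia.
- by [].
Qed.

Definition pmap_rev q : prog B :=
  PWhile (PSeq PTail PTail)
    (PCons (PCons (PSeq (PSeq PTail (PSeq PHead PHead)) q) PHead)
       (PCons (PSeq PTail (PSeq PHead PTail)) (PSeq PTail (PSeq PTail PTail)))).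

(* The list [xs] only serves as a clock: the length of [w], an output of the
   learner, is not under control. *)
Fixpoint map_rev (f : tree R -> tree R) acc w (xs : seq R) :=
  if xs is x :: xs' then map_rev f (Cons (f (head w)) acc) (tail w) xs' else acc.

Lemma runs_pmap_rev q f acc w xs :
  (forall u, runs_in q u 20 (f u)) -> exists w',
  runs_in (pmap_rev q) (Cons acc (Cons w (num_list xs))) (60 * size xs + 10)
    (Cons (map_rev f acc w xs) w').
Proof.
move=> rq; elim: xs acc w => [|x xs IHxs] acc w.
  exists (Cons w Nil); apply: runs_conv; first apply: runs_while_stop.
  - by runs.
  - by [].
  - by [].
  - by [].
have [w' IH] := IHxs (Cons (f (head w)) acc) (tail w).
exists w'; apply: runs_conv.
- apply: runs_while_step; [by runs | by [] | | exact: IH].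
  apply: runs_cons; last by runs.
  apply: runs_cons; last by runs.
  by apply: runs_seq; [runs | exact: rq].
- by rewrite /=; lia.
- by [].
Qed.

Definition pneg : prog B := PArith Sub (pnat B 0) PId.
Definition neg_tree u : tree R := Num (- num u).

Lemma runs_pneg u : runs_in pneg u 20 (neg_tree u).
Proof. by apply: runs_conv; [runs | | rewrite /= sub0r]. Qed.

(** Negates normal and threshold. [pmap_rev] reverses its list, so a second pass with the identity
    restores the order of the coordinates. *)
Definition pcomplement : prog B :=
  PCons
    (PSeq (PSeq (PCons
       (PSeq (PSeq (PCons PNil (PCons (PSeq PHead PHead) PTail)) (pmap_rev pneg)) PHead)
       PTail) (PSeq (PCons PNil PId) (pmap_rev PId))) PHead)
    (PSeq (PSeq PHead PTail) pneg).

Definition complement_tree h xs : tree R :=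
  Cons (map_rev id Nil (map_rev neg_tree Nil (head h) xs) xs) (neg_tree (tail h)).

Lemma runs_pcomplement h xs :
  runs_in pcomplement (Cons h (num_list xs)) (120 * size xs + 100)
    (complement_tree h xs).
Proof.
have [w1 r1] := runs_pmap_rev Nil (head h) xs runs_pneg.
have rid : forall u, runs_in (@PId R B) u 20 u.
  by move=> u; exact: runs_inW (runs_id _ _) _.
have [w2 r2] := runs_pmap_rev Nil (map_rev neg_tree Nil (head h) xs) xs rid.
apply: runs_conv.
- apply: runs_cons; last by apply: runs_seq; [by runs | exact: runs_pneg].
  apply: runs_seq; last exact: runs_head.
  apply: runs_seq.
    apply: runs_cons; last exact: runs_tail.
    apply: runs_seq; last exact: runs_head.
    by apply: runs_seq; [runs | exact: r1].
  by apply: runs_seq; [runs | exact: r2].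
- by rewrite /=; lia.
- by [].
Qed.

End Halfspace.

(** * The auditing program *)

Section Auditor.
Context (R : realType) (B : primitives R).
Implicit Types (p q r : prog B) (u v w h : tree R).

(* On (z, examples taken, examples left, n, a, b, e, dl), takes examples until
   z = (1 + e^2/32)^T exceeds 1/dl. *)
Definition psplit : prog B :=
  PWhile (PLeq (PArith Mul (pat B 0) (pat B 7)) POne)
    (PCons (PArith Mul (pat B 0)
              (PArith Add POne (PArith Div (PArith Mul (pat B 6) (pat B 6)) (pnat B 32))))
       (PCons (PCons (PSeq (pat B 2) PHead) (pat B 1))
          (PCons (PSeq (pat B 2) PTail) (ptails B 3)))).

Lemma runs_psplit (nn a b : tree R) e dl (T : nat) (ts : seq (seq R * bool)) :
  (T <= size ts)%N ->
  (forall j, (j < T)%N -> (1 + e * e / 32) ^+ j * dl <= 1) ->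
  1 < (1 + e * e / 32) ^+ T * dl ->
  let pars := of_seq [:: nn; a; b; Num e; Num dl] in
  runs_in psplit
    (Cons (Num 1) (Cons Nil (Cons (of_seq (map (@example R) ts)) pars)))
    (T * 300 + 100)
    (Cons (Num ((1 + e * e / 32) ^+ T))
       (Cons (of_seq (map (@example R) (rev (take T ts))))
          (Cons (of_seq (map (@example R) (drop T ts))) pars))).
Proof.
move=> leT small large pars.
set inv := fun j v => v = Cons (Num ((1 + e * e / 32) ^+ j))
  (Cons (of_seq (map (@example R) (rev (take j ts))))
     (Cons (of_seq (map (@example R) (drop j ts))) pars)).
have step j v : (j < T)%N -> inv j v ->
  (exists2 u, runs_in (PLeq (PArith Mul (pat B 0) (pat B 7)) POne) v 50 u & truth u) /\
  (exists2 v', runs_in (PCons (PArith Mul (pat B 0)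
              (PArith Add POne (PArith Div (PArith Mul (pat B 6) (pat B 6)) (pnat B 32))))
       (PCons (PCons (PSeq (pat B 2) PHead) (pat B 1))
          (PCons (PSeq (pat B 2) PTail) (ptails B 3)))) v 200 v' & inv j.+1 v').
  move=> ltj ->; split.
    eexists; first by apply: runs_conv; [by runs | | reflexivity].
    by rewrite /= small.
  have ltj' := leq_trans ltj leT.
  exists (Cons (Num ((1 + e * e / 32) ^+ j.+1))
    (Cons (of_seq (map (@example R) (rev (take j.+1 ts))))
       (Cons (of_seq (map (@example R) (drop j.+1 ts))) pars))) => //.
  apply: runs_conv; [by runs | by [] | rewrite /=].
  have x0 : seq R * bool := ([::], true).
  by rewrite (take_nth x0) // rev_rcons (drop_nth x0 ltj') /= exprSr.
have stop v : inv T v ->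
  exists2 u, runs_in (PLeq (PArith Mul (pat B 0) (pat B 7)) POne) v 50 u & ~~ truth u.
  move=> ->; eexists; first by apply: runs_conv; [by runs | | reflexivity].
  by rewrite /= leNgt large.
have inv0 : inv 0%N (Cons (Num 1)
    (Cons Nil (Cons (of_seq (map (@example R) ts)) pars))).
  by rewrite /inv expr0 take0 drop0.
have [v' rv ev] := runs_while step stop inv0; rewrite ev in rv.
by apply: runs_conv; [exact: rv | lia | reflexivity].
Qed.

(* The search state is (mu, best score, best halfspace, n, b, e, dl, tests,
   training examples). *)
Definition pcandidate p : prog B :=
  PSeq (plist [:: pat B 3; pat B 0; pat B 5; pat B 6; pat B 8]) p.

(** The clock handed to [pcomplement] is the vector of the first test example, a list of length n
    that is always at hand because the test sample is nonempty. *)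
Definition pcocandidate p : prog B :=
  PSeq (PCons
      (PSeq (plist [:: pat B 3; PArith Sub POne (pat B 0); pat B 5; pat B 6; pat B 8]) p)
      (PSeq (pat B 7) (PSeq PHead PHead)))
    (pcomplement B).

(** The intermediate trees are [(u, state)] and [(score, u, state)], where [u] is the output of [q];
    the indices refer to these. *)
Definition pupdate q : prog B :=
  PSeq (PCons q PId)
    (PSeq (PCons (PSeq (PCons PHead (PCons (PSeq PTail (pat B 0)) (PSeq PTail (pat B 7))))
              (pscore B)) PId)
       (PIf (PLeq (PSeq PTail (PSeq PTail (pat B 1))) PHead)
          (PCons (PSeq PTail (PSeq PTail PHead))
             (PCons PHead (PCons (PSeq PTail PHead) (PSeq PTail (PSeq PTail (ptails B 3))))))
          (PSeq PTail PTail))).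

Definition pround p : prog B :=
  PSeq (PSeq (pupdate (pcandidate p)) (pupdate (pcocandidate p)))
    (PCons (PArith Add (pat B 0) (pat B 5)) PTail).

Definition psearch p : prog B := PWhile (PLeq (pat B 0) (pat B 4)) (pround p).

(** * Search over the grid of masses *)

Section Search.
Variables (p : prog B) (n tau : nat) (a b e dl : R) (train : tree R).
Variables (ts : seq (seq R * bool)) (L : R -> tree R).
Hypothesis run_p : forall mu, 0 < mu < 1 ->
  runs_in p (of_seq [:: Num n%:R; Num mu; Num e; Num dl; train]) tau (L mu).
Hypothesis size_ts : all (fun xb => size xb.1 == n) ts.
Hypothesis ts_gt0 : (0 < size ts)%N.

Definition search_state mu sc best : tree R :=
  Cons (Num mu) (Cons (Num sc) (Cons best (of_seq
    [:: Num n%:R; Num b; Num e; Num dl; of_seq (map (@example R) ts); train]))).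

Definition candidate (mu : R) (side : bool) : tree R :=
  if side then L mu
  else complement_tree (L (1 - mu)) (seq.head ([::], true) ts).1.

Definition candidate_score mu side : R := `|score (candidate mu side) mu ts|.

Lemma runs_pupdate q s u mu sc best :
  runs_in q (search_state mu sc best) s u ->
  runs_in (pupdate q) (search_state mu sc best)
    (s + size ts * (50 * n + 200) + 200)
    (if sc <= `|score u mu ts| then search_state mu `|score u mu ts| u
     else search_state mu sc best).
Proof.
move=> rq; apply: runs_conv.
- apply: runs_seq; first by apply: runs_cons; [exact: rq | exact: runs_id].
  apply: runs_seq.
    apply: runs_cons; last exact: runs_id.
    by apply: runs_seq; [by runs | apply: (runs_pscore _ _ _ size_ts)].
  apply: (runs_if (t := 50%N) (w := if sc <= `|score u mu ts|
     then search_state mu `|score u mu ts| u else search_state mu sc best)).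
    by runs.
  rewrite /=; case: (sc <= _) => /=; by apply: runs_conv; [runs | | reflexivity].
- by rewrite /=; lia.
- by [].
Qed.

Lemma runs_pcandidate mu sc best : 0 < mu < 1 ->
  runs_in (pcandidate p) (search_state mu sc best) (tau + 100) (candidate mu true).
Proof.
move=> mu01; apply: runs_conv.
- by apply: runs_seq; [by runs | exact: run_p].
- by rewrite /=; lia.
- by [].
Qed.

Lemma runs_pcocandidate mu sc best : 0 < mu < 1 ->
  runs_in (pcocandidate p) (search_state mu sc best) (tau + 120 * n + 300)
    (candidate mu false).
Proof.
move=> mu01; have mu01' : 0 < 1 - mu < 1 by lra.
have [xb [ts' Ets]] : exists xb ts', ts = xb :: ts'.
  by case: ts ts_gt0 => // xb ts'; exists xb, ts'.
have sz : size (seq.head ([::], true) ts).1 = n.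
  by move: size_ts; rewrite Ets /= => /andP[/eqP].
apply: runs_conv.
- apply: runs_seq; last exact: (runs_pcomplement _ (L (1 - mu)) (seq.head ([::], true) ts).1).
  apply: runs_cons.
    apply: runs_seq; last exact: (run_p mu01').
    by apply: runs_conv; [runs | exact: leqnn | rewrite /=].
  by apply: (@runs_conv _ _ _ _ _ 30%N); [runs | | rewrite /= Ets].
- by rewrite /= sz; lia.
- by [].
Qed.

(** The search starts from the score -1 and the dummy halfspace [Nil]. Scores are absolute values,
    so the first candidate replaces the dummy; hence the invariant describes the stored halfspace
    only under [0 <= sc], and [0 < K] discharges this at the end. *)
Lemma runs_psearch K : 0 < a -> b < 1 -> 0 < e ->
  (0 < K)%N -> (forall j, (j < K)%N -> a + j%:R * e <= b) -> b < a + K%:R * e ->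
  exists j side mu, [/\ (j < K)%N,
    (forall j' side', (j' < K)%N -> candidate_score (a + j'%:R * e) side' <=
       candidate_score (a + j%:R * e) side) &
    runs_in (psearch p) (search_state a (-1) Nil)
      (K * (2 * tau + 120 * n + 2 * (size ts * (50 * n + 200)) + 1000) + 100)
      (search_state mu (candidate_score (a + j%:R * e) side)
        (candidate (a + j%:R * e) side))].
Proof.
move=> a0 b1 e0 K0 small large.
pose mu j : R := a + j%:R * e.
pose inv j v := exists sc best, [/\ v = search_state (mu j) sc best,
  -1 <= sc,
  (forall j' side', (j' < j)%N -> candidate_score (mu j') side' <= sc) &
  0 <= sc -> exists j' side, [/\ (j' < j)%N, sc = candidate_score (mu j') side &
    best = candidate (mu j') side]].
have step j v : (j < K)%N -> inv j v ->
  (exists2 u, runs_in (PLeq (pat B 0) (pat B 4)) v 30 u & truth u) /\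
  (exists2 v', runs_in (pround p) v
     (2 * tau + 120 * n + 2 * (size ts * (50 * n + 200)) + 950) v' & inv j.+1 v').
  move=> ltj [sc [best [-> sc1 scmax scbest]]]; split.
    eexists; first by apply: runs_conv; [by runs | | reflexivity].
    by rewrite /= small.
  have muj : 0 < mu j < 1.
    have := small _ ltj; have : 0 <= j%:R * e by rewrite mulr_ge0// ltW.
    by rewrite /mu; lra.
  have upd q s u sc' best' : runs_in q (search_state (mu j) sc' best') s u ->
    -1 <= sc' -> exists sc'' best'', [/\ runs_in (pupdate q) (search_state (mu j) sc' best')
      (s + size ts * (50 * n + 200) + 200) (search_state (mu j) sc'' best''),
      sc' <= sc'', `|score u (mu j) ts| <= sc'' &
      (sc'' = `|score u (mu j) ts| /\ best'' = u) \/
        (sc'' = sc' /\ best'' = best')].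
    move=> /runs_pupdate rq sc1'; have [le|lt] := leP sc' `|score u (mu j) ts|.
      exists `|score u (mu j) ts|, u; split=> //; last by left.
      by rewrite le in rq.
    exists sc', best'; split => //; last first.
    - by right.
    - exact: ltW.
    - by rewrite leNgt lt in rq.
  have [sc2 [best2 [r2 le2 le2' or2]]] := upd _ _ _ _ _ (runs_pcandidate sc best muj) sc1.
  have [sc3 [best3 [r3 le3 le3' or3]]] :=
    upd _ _ _ _ _ (runs_pcocandidate sc2 best2 muj) (le_trans sc1 le2).
  exists (search_state (mu j.+1) sc3 best3).
    apply: runs_conv.
    - by apply: runs_seq; [apply: runs_seq; [exact: r2|exact: r3] | runs].
    - rewrite /=; move: (size ts * _)%N (120 * n)%N => M N; clear; lia.
    - by rewrite /= /search_state /mu -[in RHS]natr1 mulrDl mul1r addrA.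
  exists sc3, best3; split => //.
  - by rewrite (le_trans sc1) // (le_trans le2).
  - move=> j' side'; rewrite ltnS leq_eqVlt => /orP[/eqP ->|lt].
      by case: side'; [exact: le_trans le2' le3 | exact: le3'].
    by rewrite (le_trans (scmax _ _ lt)) // (le_trans le2).
  - case: or3 => [[-> ->]|[-> ->]]; first by exists j, false.
    case: or2 => [[-> ->]|[-> ->]]; first by exists j, true.
    by move/scbest => [j' [side [ltj' -> ->]]]; exists j', side; rewrite ltnS ltnW.
have stop v : inv K v ->
  exists2 u, runs_in (PLeq (pat B 0) (pat B 4)) v 30 u & ~~ truth u.
  move=> [sc [best [-> _ _ _]]]; eexists.
    by apply: runs_conv; [by runs | | reflexivity].
  by rewrite /= leNgt large.
have inv0 : inv 0%N (search_state a (-1) Nil).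
  exists (-1), Nil; split => //; first by rewrite /mu mul0r addr0.
  by rewrite leNgt ltrN10.
have [v' rv [sc [best [ev' _ scmax scbest]]]] := runs_while step stop inv0.
have [|j [side [ltj Esc Ebest]]] := scbest.
  by apply: le_trans (scmax 0%N true K0); exact: normr_ge0.
exists j, side, (mu K); split => //.
  by move=> j' side' /scmax; rewrite -/(mu j') -/(mu j) -Esc; exact.
rewrite -Esc -Ebest -ev'.
apply: runs_conv; [exact: rv | | reflexivity].
by move: (2 * tau + _ + _)%N => M; clear; lia.
Qed.

End Search.

(** The examples taken by [psplit] become the test sample and the untouched rest is passed on to the
    learner. The three lists are wired by position: the initial state of [psplit], then that of
    [psearch], whose entry 2 is the best halfspace at the end. *)
Definition paudit p : prog B :=
  let pe := PArith Div (pat B 3) (pnat B 4) in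
  let pdl := PArith Div (PArith Mul (pat B 4) pe) (pnat B 12) in
  PSeq (PSeq (PSeq (PSeq
      (plist [:: POne; PNil; pat B 5; pat B 0; pat B 1; pat B 2; pe; pdl])
      psplit)
      (plist [:: pat B 4; PArith Sub (pnat B 0) POne; PNil; pat B 3; pat B 5; pat B 6;
        pat B 7; pat B 1; pat B 2]))
      (psearch p)) (pat B 2).

Lemma runs_paudit p n tau (a b eps delta : R) K T (smp : seq (seq R * bool))
    (L : R -> tree R) :
  let e := eps / 4 in
  let dl := delta * e / 12 in
  let train := of_seq (map (@example R) (drop T smp)) in
  let ts := rev (take T smp) in
  0 < a -> b < 1 -> 0 < eps ->
  (forall mu, 0 < mu < 1 ->
    runs_in p (of_seq [:: Num n%:R; Num mu; Num e; Num dl; train]) tau (L mu)) ->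
  all (fun xb => size xb.1 == n) smp ->
  (0 < T <= size smp)%N ->
  (forall j, (j < T)%N -> (1 + e * e / 32) ^+ j * dl <= 1) ->
  1 < (1 + e * e / 32) ^+ T * dl ->
  (0 < K)%N -> (forall j, (j < K)%N -> a + j%:R * e <= b) -> b < a + K%:R * e ->
  exists j side, [/\ (j < K)%N,
    (forall j' side', (j' < K)%N ->
       candidate_score ts L (a + j'%:R * e) side' <=
       candidate_score ts L (a + j%:R * e) side) &
    runs_in (paudit p)
      (of_seq [:: Num n%:R; Num a; Num b; Num eps; Num delta;
         of_seq (map (@example R) smp)])
      (K * (2 * tau + 120 * n + 2 * (T * (50 * n + 200)) + 1000) + 300 * T + 1000)
      (candidate ts L (a + j%:R * e) side)].
Proof.
move=> e dl train ts a0 b1 eps0 run_p szs /andP[T0 leT] Tsmall Tlarge K0 Ksmall Klarge.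
have szts : size ts = T by rewrite size_rev size_takel.
have allts : all (fun xb => size xb.1 == n) ts.
  rewrite all_rev; apply/allP => x /mem_take; exact: (allP szs).
have ts0 : (0 < size ts)%N by rewrite szts.
have e0 : 0 < e by rewrite divr_gt0.
have [j [side [mu [ltj maxj rs]]]] :=
  runs_psearch run_p allts ts0 a0 b1 e0 K0 Ksmall Klarge.
exists j, side; split => //.
have rsplit := runs_psplit (Num n%:R) (Num a) (Num b) leT Tsmall Tlarge.
apply: runs_conv.
- apply: runs_seq; last exact: (runs_pat _ 2).
  apply: runs_seq; last exact: rs.
  apply: runs_seq.
    apply: runs_seq; last exact: rsplit.
    by apply: runs_conv; [runs | exact: leqnn | reflexivity].
  apply: runs_conv; [by runs | exact: leqnn |].
  by rewrite /search_state /= ?subrr sub0r.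
- rewrite /= szts; move: (2 * tau + _ + _ + _)%N => M; clear; lia.
- by [].
Qed.

End Auditor.

(** * Programs compute measurable functions *)

Section TreeMeasurable.
Context d (T : measurableType d) (R : realType).
Implicit Types (f g : T -> tree R).

Definition kind (v : tree R) : nat :=
  match v with Nil => 0 | Num _ => 1 | Cons _ _ => 2 end.

Definition subtree (v : tree R) (path : seq bool) : tree R :=
  foldl (fun v b => if b then tail v else head v) v path.

(** Trees carry the coarsest sigma-algebra that makes the shape and all the
    leaves measurable. *)
Definition tree_measurable f := forall path,
  measurable_fun [set: T] (fun s => kind (subtree (f s) path)) /\
  measurable_fun [set: T] (fun s => num (subtree (f s) path)).

Lemma subtree_Nil path : subtree Nil path = Nil.
Proof. by elim: path => [|[] path]. Qed.

Lemma tree_measurable_Nil : tree_measurable (fun=> Nil).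
Proof.
by move=> path; split; under eq_fun do rewrite subtree_Nil; exact: measurable_cst.
Qed.

Lemma tree_measurable_Num (x : T -> R) :
  measurable_fun [set: T] x -> tree_measurable (fun s => Num (x s)).
Proof.
move=> mx [|b path]; first by split; [exact: measurable_cst | exact: mx].
have E s : subtree (Num (x s)) (b :: path) = Nil.
  by case: b; exact: subtree_Nil.
by split; under eq_fun do rewrite E; exact: measurable_cst.
Qed.

Lemma tree_measurable_Cons f g : tree_measurable f -> tree_measurable g ->
  tree_measurable (fun s => Cons (f s) (g s)).
Proof.
move=> mf mg [|[] path]; first by split; exact: measurable_cst.
- exact: mg path.
- exact: mf path.
Qed.

Lemma tree_measurable_head f : tree_measurable f ->
  tree_measurable (fun s => head (f s)).
Proof. by move=> mf path; exact: mf (false :: path). Qed.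

Lemma tree_measurable_tail f : tree_measurable f ->
  tree_measurable (fun s => tail (f s)).
Proof. by move=> mf path; exact: mf (true :: path). Qed.

Lemma tree_measurable_num f : tree_measurable f ->
  measurable_fun [set: T] (fun s => num (f s)).
Proof. by move=> mf; exact: (mf [::]).2. Qed.

Lemma tree_measurable_if (b : T -> bool) f g : measurable_fun [set: T] b ->
  tree_measurable f -> tree_measurable g ->
  tree_measurable (fun s => if b s then f s else g s).
Proof.
move=> mb mf mg path; have [mf1 mf2] := mf path; have [mg1 mg2] := mg path.
split.
- rewrite (_ : (fun s => _) = fun s =>
    if b s then kind (subtree (f s) path) else kind (subtree (g s) path)).
    exact: measurable_fun_ifT.
  by apply/funext => s; case: (b s).
- rewrite (_ : (fun s => _) = fun s =>
    if b s then num (subtree (f s) path) else num (subtree (g s) path)).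
    exact: measurable_fun_ifT.
  by apply/funext => s; case: (b s).
Qed.

Lemma measurable_truth f : tree_measurable f ->
  measurable_fun [set: T] (fun s => truth (f s)).
Proof.
move=> mf; have [mk _] := mf [::].
rewrite (_ : (fun s => _) = (fun k : nat => k != 0%N) \o (fun s => kind (f s))).
  by apply: measurableT_comp mk.
by apply/funext => s /=; case: (f s).
Qed.

Lemma tree_measurable_of_seq (fs : seq (T -> tree R)) :
  (forall i, tree_measurable (nth (fun=> Nil) fs i)) ->
  tree_measurable (fun s => of_seq [seq f s | f <- fs]).
Proof.
elim: fs => [|f fs IH] mfs; first exact: tree_measurable_Nil.
apply: tree_measurable_Cons; first exact: mfs 0%N.
by apply: IH => i; exact: mfs i.+1.
Qed.

(** Inversion is total and discontinuous at 0; on each half-line it is a real power, up to sign. *)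
Lemma measurable_inv : measurable_fun [set: R] (fun x : R => x^-1).
Proof.
rewrite (_ : (fun x : R => x^-1) = fun x =>
  if 0 <= x then x `^ (-1) else - ((- x) `^ (-1))).
  apply: measurable_fun_ifT.
  - by apply: measurable_fun_ler => //; exact: measurable_cst.
  - exact: measurable_powR.
  - apply: measurableT_comp => //.
    apply: (measurableT_comp (measurable_powR (-1))); exact: oppr_measurable.
apply/funext => x; case: lerP => [x0|x0]; first by rewrite powR_inv1.
by rewrite powR_inv1 ?oppr_ge0 ?ltW // invrN opprK.
Qed.

Lemma measurable_arith o (x y : T -> R) : measurable_fun [set: T] x ->
  measurable_fun [set: T] y -> measurable_fun [set: T] (fun s => arith_fun o (x s) (y s)).
Proof.
move=> mx my; case: o => /=.
- exact: measurable_funD.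
- exact: measurable_funB.
- exact: measurable_funM.
- apply: measurable_funM => //.
  exact: (measurableT_comp measurable_inv my).
Qed.

(** Each number of the prefix is a leaf at a fixed path, so once the length of the prefix is fixed
    its entries are measurable. *)
Lemma nums_mkseq (v : tree R) :
  nums v = mkseq (fun i => num (subtree v (rcons (nseq i true) false))) (size (nums v)).
Proof.
rewrite /mkseq; elim: v => //= -[|x|v1 v2] IH1 u IHu //=.
congr (_ :: _).
by rewrite [LHS]IHu (iotaDl 1 0) -map_comp.
Qed.

Lemma measurable_size_nums f n : tree_measurable f ->
  measurable [set s | (n <= size (nums (f s)))%N].
Proof.
elim: n f => [|n IH] f mf.
  by rewrite (_ : [set s | _] = setT) //; apply/seteqP.
rewrite (_ : [set s | _] =
   (fun s => kind (subtree (f s) [:: false])) @^-1` [set 1%N] `&`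
   [set s | (n <= size (nums (tail (f s))))%N]).
  apply: measurableI; last exact/IH/tree_measurable_tail.
  by rewrite -[X in measurable X]setTI; exact: (mf [:: false]).1.
apply/seteqP; split => s /=.
  by case: (f s) => // -[|x|u1 u2] w //=; rewrite ltnS.
by case: (f s) => [|x|[|x|u1 u2] w] [//= _]; rewrite ltnS.
Qed.

(** A primitive is known to be measurable for each arity separately. The domain is cut into the
    countably many events on which the argument list has a given length. *)
Lemma measurable_prim (B : primitives R) k f : tree_measurable f ->
  measurable_fun [set: T] (fun s => prim_fun (p := B) k (nums (f s))).
Proof.
move=> mf; pose E n := [set s | size (nums (f s)) = n].
have mE n : measurable (E n).
  rewrite (_ : E n = [set s | (n <= size (nums (f s)))%N] `\`
                     [set s | (n.+1 <= size (nums (f s)))%N]).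
    by apply: measurableD; exact: measurable_size_nums.
  apply/seteqP; split => s /=; rewrite /E /=; first by move=> ->; rewrite ltnn leqnn.
  by move=> [le /negP]; rewrite -leqNgt => le'; apply/eqP; rewrite eqn_leq le le'.
have -> : [set: T] = \bigcup_n E n.
  by apply/seteqP; split => // s _; exists (size (nums (f s))).
apply/measurable_fun_bigcup => // n.
pose x s : n.-tuple R := [tuple num (subtree (f s) (rcons (nseq i true) false)) | i < n].
apply: (@eq_measurable_fun _ _ _ _ _ (fun s => prim_fun (p := B) k (x s))).
  move=> s /[!inE] En; rewrite [in RHS]nums_mkseq En; congr (prim_fun k _).
  by rewrite /x /mkseq -val_enum_ord -map_comp.
apply: measurable_funTS.
apply: (measurableT_comp (prim_measurable k (n := n))).
apply/measurable_fun_tnthP => i.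
rewrite (_ : _ \o _ = fun s => num (subtree (f s) (rcons (nseq i true) false))).
  exact: (mf _).2.
by apply/funext => s /=; rewrite tnth_mktuple.
Qed.

Lemma tree_measurable_eval (B : primitives R) N (p : prog B) f : tree_measurable f ->
  tree_measurable (fun s => eval N p (f s)).
Proof.
elim: p f => /=.
- by move=> f mf path; exact: mf path.
- move=> f mf; exact: tree_measurable_Nil.
- by move=> f mf; exact/tree_measurable_Num/measurable_cst.
- by move=> f mf; exact: tree_measurable_head.
- by move=> f mf; exact: tree_measurable_tail.
- by move=> p IHp q IHq f mf; apply: tree_measurable_Cons; [exact: IHp | exact: IHq].
- by move=> p IHp q IHq f mf; exact/IHq/IHp.
- move=> o p IHp q IHq f mf; apply/tree_measurable_Num/measurable_arith.
    exact/tree_measurable_num/IHp.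
  exact/tree_measurable_num/IHq.
- move=> p IHp q IHq f mf; apply: tree_measurable_if.
  + by apply: measurable_fun_ler; apply/tree_measurable_num; [exact: IHp | exact: IHq].
  + by apply: tree_measurable_Cons; exact: tree_measurable_Nil.
  + exact: tree_measurable_Nil.
- by move=> k p IHp f mf; apply/tree_measurable_Num/measurable_prim/IHp.
- move=> p IHp q IHq r IHr f mf; apply: tree_measurable_if; first exact/measurable_truth/IHp.
    exact: IHq.
  exact: IHr.
- move=> p IHp q IHq f mf.
  suff H m : tree_measurable (fun s => iter m (fun v =>
      if truth (eval N p v) then eval N q v else v) (f s)) by exact: H.
  elim: m => [|m IHm] /=; first exact: mf.
  apply: tree_measurable_if => //; first exact/measurable_truth/IHp.
  exact: IHq.
Qed.

End TreeMeasurable.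

(** * A Chernoff bound for a test sample *)

Section IidTheory.
Context d (T : measurableType d) (R : realType) (D : probability T R).
Implicit Types m k : nat.

(** Recursion on [k] avoids casts: [k'.+1 + m] computes to [(k' + m).+1], in step with the recursion
    of [iid]. *)
Fixpoint tuple_drop m k : (k + m).-tuple T -> m.-tuple T :=
  match k with
  | 0 => id
  | k'.+1 => fun s => tuple_drop [tuple of behead s]
  end.

Lemma val_tuple_drop m k (s : (k + m).-tuple T) :
  tuple_drop s = drop k s :> seq T.
Proof.
elim: k s => [|k IHk] s /=; first by rewrite drop0.
by rewrite IHk /= -drop1 drop_drop addn1.
Qed.

Lemma measurable_tuple_drop m k :
  measurable_fun [set: (k + m).-tuple T] (@tuple_drop m k).
Proof.
elim: k => [|k IHk]; first exact: measurable_id.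
exact: (measurableT_comp IHk (measurable_behead (n := k + m))).
Qed.

Lemma behead_consT m (z : T * m.-tuple T) : [tuple of behead (consT z)] = z.2.
Proof. exact: val_inj. Qed.

(** Tonelli, with the first draw in the inner integral, so that it is averaged while all later draws
    are held fixed. *)
Lemma ge0_integral_iid m (f : m.+1.-tuple T -> \bar R) :
  measurable_fun [set: m.+1.-tuple T] f -> (forall s, 0 <= f s)%E ->
  (\int[iid D m.+1]_s f s = \int[iid D m]_s \int[D]_x f (consT (x, s)))%E.
Proof.
move=> mf f0.
rewrite [LHS](ge0_integral_pushforward (@measurable_consT _ T m)) //=.
rewrite preimage_setT fubini_tonelli2 //.
exact: (measurableT_comp mf (@measurable_consT _ T m)).
Qed.

Lemma iid_tuple_drop m k (F : set (m.-tuple T)) : measurable F ->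
  iid D (k + m) (@tuple_drop m k @^-1` F) = iid D m F.
Proof.
move=> mF; elim: k => [//|k IHk].
rewrite -IHk [LHS]/= /pushforward.
rewrite (_ : _ @^-1` _ = setT `*` (@tuple_drop m k @^-1` F)); last first.
  apply/seteqP; split => z /=; rewrite -[X in tuple_drop X]/(_) behead_consT //.
  by case.
rewrite product_measure1E //; last first.
  by rewrite -[X in measurable X]setTI; exact: measurable_tuple_drop.
rewrite [X in (X * _)%E](_ : _ = 1%E) ?mul1e //; exact: probability_setT.
Qed.

(** * Products over test points of a function chosen by the training sample *)

Section ProductBound.
Variables (m : nat) (phi : m.-tuple T -> T -> R) (rho : R).
Hypothesis mphi :
  measurable_fun [set: m.-tuple T * T] (fun z => phi z.1 z.2).
Hypothesis phi0 : forall s x, 0 <= phi s x.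
Hypothesis phi_le : forall s, (\int[D]_x (phi s x)%:E <= rho%:E)%E.

Lemma measurable_prod_take k : measurable_fun [set: (k + m).-tuple T]
  (fun s : (k + m).-tuple T => \prod_(x <- take k s) phi (tuple_drop s) x).
Proof.
elim: k => [|k IHk].
  by under eq_fun do rewrite take0 big_nil; exact: measurable_cst.
rewrite (_ : (fun s => _) = fun s : (k.+1 + m).-tuple T =>
  phi (tuple_drop s) (thead s) *
  \prod_(x <- take k [tuple of behead s]) phi (tuple_drop [tuple of behead s]) x).
  apply: measurable_funM.
    apply: (@measurableT_comp _ _ _ _ _ _ (fun z : m.-tuple T * T => phi z.1 z.2)
       _ (fun s : (k.+1 + m).-tuple T => (tuple_drop s, thead s))) => //.
    apply: measurable_fun_pair; first exact: measurable_tuple_drop.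
    exact: measurable_tnth.
  exact: (measurableT_comp IHk (measurable_behead (n := k + m))).
apply/funext => s; case/tupleP: s => x s.
by rewrite /= big_cons theadE.
Qed.

Lemma emeasurable_prod_take k : measurable_fun [set: (k + m).-tuple T]
  (fun s : (k + m).-tuple T => (\prod_(x <- take k s) phi (tuple_drop s) x)%:E).
Proof. by apply: measurableT_comp => //; exact: measurable_prod_take. Qed.

Lemma prod_take_cons k (s : (k + m).-tuple T) x :
  \prod_(y <- take k.+1 (consT (x, s))) phi (tuple_drop (k := k.+1) (consT (x, s))) y =
  (\prod_(y <- take k s) phi (tuple_drop s) y) * phi (tuple_drop s) x.
Proof. by rewrite /= big_cons behead_consT mulrC. Qed.

(** The first test point is independent of the other test points and of the training sample.
    Integrating it first costs a factor at most [rho] for each fixed value of the rest, and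
    induction on [k] removes exactly the test points. *)
Lemma integral_prod_take k :
  (\int[iid D (k + m)]_s (\prod_(x <- take k s) phi (tuple_drop s) x)%:E
     <= (rho ^+ k)%:E)%E.
Proof.
(* The bound at an arbitrary training sample already gives the sign of [rho]. *)
have rho0 : 0 <= rho.
  rewrite -lee_fin; apply: le_trans (phi_le (nseq_tuple m point)).
  by apply: integral_ge0 => x _; rewrite lee_fin.
have prod0 k' (s : (k' + m).-tuple T) :
    0 <= \prod_(x <- take k' s) phi (tuple_drop s) x.
  by apply: prodr_ge0.
elim: k => [|k IHk].
  under eq_integral do rewrite take0 big_nil.
  by rewrite integral_cst //= mul1e; exact: probability_le1.
rewrite ge0_integral_iid; last first.
- by move=> s; rewrite lee_fin; exact: prod0.
- exact: (@emeasurable_prod_take k.+1).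
have mphi' s : measurable_fun [set: T] (EFin \o phi s).
  apply: measurableT_comp => //.
  exact: (measurableT_comp mphi (measurable_pair1 s)).
rewrite (eq_integral (fun s : (k + m).-tuple T =>
    (\prod_(y <- take k s) phi (tuple_drop s) y)%:E *
       \int[D]_x (phi (tuple_drop s) x)%:E)%E); last first.
  move=> s _; rewrite -ge0_integralZl_EFin //; last 2 first.
  - by move=> x _; rewrite lee_fin.
  - exact: mphi'.
  by apply: eq_integral => x _; rewrite -EFinM -prod_take_cons.
apply: (@le_trans _ _ (\int[iid D (k + m)]_s
   (rho%:E * (\prod_(x <- take k s) phi (tuple_drop s) x)%:E))%E).
  apply: ge0_le_integral => //.
  - move=> s _; apply: mule_ge0; first by rewrite lee_fin.
    by apply: integral_ge0 => x _; rewrite lee_fin.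
  - apply: emeasurable_funM; first exact: emeasurable_prod_take.
    apply: (@measurableT_comp _ _ _ _ _ _ (fun s => \int[D]_x (phi s x)%:E)%E _
      (@tuple_drop m k)); last exact: measurable_tuple_drop.
    apply: (@measurable_fun_fubini_tonelli_F _ _ _ _ R D (fun z => (phi z.1 z.2)%:E)).
      by apply: measurableT_comp.
    by move=> z; rewrite lee_fin.
  - by apply: emeasurable_funM => //; exact: emeasurable_prod_take.
  - by move=> s _; rewrite muleC lee_wpmul2r // lee_fin.
rewrite ge0_integralZl_EFin //.
- by rewrite exprS EFinM lee_wpmul2l // lee_fin.
- by move=> s _; rewrite lee_fin.
- exact: emeasurable_prod_take.
Qed.

End ProductBound.

(** From [1 - y <= expR (- y)] follows [expR y <= 1 / (1 - y)], and (1 - y)(1 + y + 2y^2) = 1 + y^2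
    (1 - 2y) >= 1. *)
Lemma expR_le_quadratic (y : R) : y <= 1 / 2 -> expR y <= 1 + y + 2 * y ^+ 2.
Proof.
move=> y_le; rewrite -[y in expR y]opprK expRN.
have ge := expR_ge1Dx (- y).
have pos : 0 < 1 - y by lra.
apply: (@le_trans _ _ (1 - y)^-1); first by rewrite lef_pV2 ?posrE ?expR_gt0.
rewrite -[leLHS]mul1r ler_pdivrMr //.
have : 0 <= y ^+ 2 * (1 - 2 * y) by rewrite mulr_ge0 ?sqr_ge0 //; lra.
nra.
Qed.

Lemma integrable_bounded1 (Y : T -> R) : measurable_fun [set: T] Y ->
  (forall x, `|Y x| <= 1) -> D.-integrable [set: T] (EFin \o Y).
Proof.
move=> mY Y1; apply: measurable_bounded_integrable => //.
  by apply: le_lt_trans (probability_le1 D measurableT) _; exact: ltry.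
exists 1; split => // M M1 x _; exact: le_trans (Y1 x) (ltW M1).
Qed.

Lemma integral_affine (Y : T -> R) (y a b : R) : measurable_fun [set: T] Y ->
  (forall x, `|Y x| <= 1) -> (\int[D]_x (Y x)%:E = y%:E)%E ->
  (\int[D]_x (a + b * Y x)%:E = (a + b * y)%:E)%E.
Proof.
move=> mY Y1 Ey; have iY := integrable_bounded1 mY Y1.
under eq_integral do rewrite EFinD EFinM.
rewrite integralD //=; last 2 first.
- exact: finite_measure_integrable_cst.
- exact: integrableZl.
rewrite integral_cst // integralZl // Ey.
rewrite [X in (a%:E * X + _)%E](_ : _ = 1%E) ?mule1; last exact: probability_setT.
by rewrite -EFinM -EFinD.
Qed.

(** With s = eta/16 the quadratic bound gives at most exp(- s eta)(1 + 8 s^2) <= exp(8 s^2 - s eta)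
    = exp(- eta^2/32); this s minimizes the exponent. The weaker form 1/(1 + eta^2/32) is kept
    because its powers can be computed by the machine. *)
Lemma integral_expR_deviation (Y : T -> R) (y eta : R) : measurable_fun [set: T] Y ->
  (forall x, `|Y x| <= 1) -> (\int[D]_x (Y x)%:E = y%:E)%E -> 0 < eta <= 1 ->
  (\int[D]_x (expR (eta / 16 * (Y x - y - eta)))%:E
     <= ((1 + eta * eta / 32)^-1)%:E)%E.
Proof.
move=> mY Y1 Ey /andP[eta0 eta1].
(* [1 + Y] and [1 - Y] are nonnegative, hence so are their integrals. *)
have y1 : `|y| <= 1.
  have := integral_affine (1) (1) mY Y1 Ey.
  have := integral_affine (1) (-1) mY Y1 Ey.
  have H b : `|b| = 1 -> (0 <= \int[D]_x (1 + b * Y x)%:E)%E.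
    move=> b1; apply: integral_ge0 => x _; rewrite lee_fin.
    have : `|b * Y x| <= 1 by rewrite normrM b1 mul1r.
    by rewrite ler_norml => /andP[]; lra.
  have := H (-1); have := H 1; rewrite normrN normr1 => /(_ erefl) H1 /(_ erefl) H2 E2 E1.
  move: H1 H2; rewrite E1 E2 !lee_fin ler_norml => *; apply/andP; split; lra.
pose s := eta / 16.
have s0 : 0 < s by rewrite /s divr_gt0.
(* The square of [Y - y] is replaced by its upper bound 4, which leaves a majorant affine in [Y];
   only the mean of [Y] is then needed. *)
pose a := expR (- s * eta) * (1 + 8 * s ^+ 2 - s * y).
pose b := expR (- s * eta) * s.
apply: (@le_trans _ _ (\int[D]_x (a + b * Y x)%:E)%E).
  have le x : expR (s * (Y x - y - eta)) <= a + b * Y x.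
    rewrite (_ : s * _ = - s * eta + s * (Y x - y)); last by ring.
    rewrite expRD /a /b -mulrA -mulrDr ler_pM2l ?expR_gt0 //.
    have := Y1 x; move: y1; rewrite !ler_norml => /andP[? ?] /andP[? ?].
    apply: le_trans (expR_le_quadratic _) _.
      have : s * (Y x - y) <= s * 2 by rewrite ler_pM2l //; lra.
      by rewrite /s; lra.
    have : (Y x - y) ^+ 2 <= 4 by nra.
    have s20 : 0 <= s ^+ 2 by exact: sqr_ge0.
    move=> /(ler_wpM2l s20); rewrite -exprMn; lra.
  apply: ge0_le_integral => //.
  - apply: measurableT_comp => //; apply: measurableT_comp => //.
    apply: measurable_funM => //; apply: measurable_funB => //.
    exact: measurable_funB.
  - apply: measurableT_comp => //; apply: measurable_funD => //.
    exact: measurable_funM.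
  - by move=> x _; rewrite lee_fin le.
rewrite (integral_affine _ _ mY Y1 Ey) lee_fin /a /b.
rewrite [leLHS](_ : _ = expR (- s * eta) * (1 + 8 * s ^+ 2)); last by ring.
apply: (@le_trans _ _ (expR (- s * eta) * expR (8 * s ^+ 2))).
  by rewrite ler_pM2l ?expR_gt0 // expR_ge1Dx.
rewrite -expRD (_ : - s * eta + _ = - (eta * eta / 32)); last by rewrite /s; field.
rewrite expRN lef_pV2 ?posrE ?expR_gt0 ?expR_ge1Dx //.
have : 0 <= eta * eta by rewrite mulr_ge0 // ltW.
lra.
Qed.

(** * One-sided deviation of the test mean *)

Section Deviation.
Variables (m k : nat) (X : m.-tuple T -> T -> R) (g : m.-tuple T -> R) (eta : R).
Hypothesis mX : measurable_fun [set: m.-tuple T * T] (fun z => X z.1 z.2).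
Hypothesis X1 : forall s x, `|X s x| <= 1.
Hypothesis Xg : forall s, (\int[D]_x (X s x)%:E = (g s)%:E)%E.
Hypothesis eta01 : 0 < eta <= 1.

Let mX1 s : measurable_fun [set: T] (X s).
Proof. exact: (measurableT_comp mX (measurable_pair1 s)). Qed.

(** Adding 1 makes the integrand nonnegative, so that Tonelli gives measurability of the partial
    integral. *)
Lemma measurable_mean : measurable_fun [set: m.-tuple T] g.
Proof.
have E s : (\int[D]_x (1 + 1 * X s x)%:E = (1 + 1 * g s)%:E)%E.
  exact: integral_affine.
rewrite (_ : g = fun s => fine (\int[D]_x (1 + 1 * X s x)%:E)%E - 1); last first.
  by apply/funext => s; rewrite E /=; lra.
apply: measurable_funB => //; apply: measurableT_comp => //.
apply: (@measurable_fun_fubini_tonelli_F _ _ _ _ R D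
  (fun z => (1 + 1 * X z.1 z.2)%:E)).
  apply: measurableT_comp => //; apply: measurable_funD => //.
  exact: measurable_funM.
by move=> z; rewrite lee_fin; have := X1 z.1 z.2; rewrite ler_norml; lra.
Qed.

Definition upper_deviation : set ((k + m).-tuple T) :=
  [set s | k%:R * (g (tuple_drop s) + eta) <= \sum_(x <- take k s) X (tuple_drop s) x].

Let phi s x := expR (eta / 16 * (X s x - g s - eta)).

Let mphi : measurable_fun [set: m.-tuple T * T] (fun z => phi z.1 z.2).
Proof.
apply: measurableT_comp => //; apply: measurable_funM => //.
apply: measurable_funB => //; apply: measurable_funB => //.
apply: (measurableT_comp measurable_mean); exact: measurable_fst.
Qed.

Let phi_prod (s : (k + m).-tuple T) :
  \prod_(x <- take k s) phi (tuple_drop s) x =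
  expR (eta / 16 * (\sum_(x <- take k s) X (tuple_drop s) x -
     k%:R * (g (tuple_drop s) + eta))).
Proof.
have sz : size (take k s) = k by rewrite size_takel // size_tuple leq_addr.
rewrite -[in k%:R]sz; elim: (take k s) => [|x l IH].
  by rewrite !big_nil mul0r subrr mulr0 expR0.
rewrite !big_cons IH -expRD; congr expR => /=.
rewrite -natr1; ring.
Qed.

Lemma measurable_upper_deviation : measurable upper_deviation.
Proof.
rewrite (_ : upper_deviation =
  (fun s : (k + m).-tuple T => 1 <= \prod_(x <- take k s) phi (tuple_drop s) x)
    @^-1` [set true]).
  rewrite -[X in measurable X]setTI; apply: measurable_fun_ler => //.
  exact: measurable_prod_take.
apply/seteqP; split => s /=; rewrite /upper_deviation /= phi_prod -expR0 ler_expR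
  pmulr_rge0 ?subr_ge0 //; case/andP: eta01 => eta0 _; exact: divr_gt0.
Qed.

(** Markov's inequality in exponential form: on the event the product of the [phi] is at least 1. *)
Lemma upper_deviation_le :
  (iid D (k + m) upper_deviation <= (((1 + eta * eta / 32)^-1) ^+ k)%:E)%E.
Proof.
have mdev := measurable_upper_deviation.
have phi0 s x : 0 <= phi s x by exact: expR_ge0.
have phile s : (\int[D]_x (phi s x)%:E <= ((1 + eta * eta / 32)^-1)%:E)%E.
  exact: integral_expR_deviation.
apply: le_trans (integral_prod_take mphi phi0 phile k).
rewrite -[upper_deviation]setIT -integral_indic //.
apply: ge0_le_integral => //.
- by apply: measurableT_comp => //; exact: measurable_indic.
- exact: emeasurable_prod_take.
- move=> s _; rewrite lee_fin indicE; case: (boolP (s \in upper_deviation)) => /=.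
    rewrite inE /upper_deviation /= => dev; rewrite phi_prod -[leLHS]expR0 ler_expR.
    rewrite pmulr_rge0; first by rewrite subr_ge0.
    by case/andP: eta01 => eta0 _; rewrite divr_gt0.
  by move=> _; apply: prodr_ge0.
Qed.

End Deviation.
End IidTheory.

(** * Halfspaces and their gap *)

Section Halfspaces.
Context (R : realType) (n : nat) (D : probability (n.-tuple R) R).
Implicit Types (w x : n.-tuple R) (c h : n.-tuple R -> bool) (A B : set (n.-tuple R)).

Lemma pr_ge0 A : 0 <= pr D A.
Proof. by apply: fine_ge0; exact: measure_ge0. Qed.

Lemma EFin_pr A : measurable A -> D A = (pr D A)%:E.
Proof. by move=> mA; rewrite fineK // fin_num_measure. Qed.

Lemma pr_le1 A : measurable A -> pr D A <= 1.
Proof. by move=> mA; rewrite -lee_fin -EFin_pr //; exact: probability_le1. Qed.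

Lemma pr_setT : pr D [set: n.-tuple R] = 1.
Proof. by rewrite /pr probability_setT. Qed.

Lemma pr_setU A B : measurable A -> measurable B -> A `&` B = set0 ->
  pr D (A `|` B) = pr D A + pr D B.
Proof.
move=> mA mB AB0; apply: EFin_inj.
rewrite EFinD -!EFin_pr //; last exact: measurableU.
exact: measureU.
Qed.

Lemma pr_setID A B : measurable A -> measurable B ->
  pr D A = pr D (A `&` B) + pr D (A `\` B).
Proof.
move=> mA mB; rewrite -pr_setU ?setUIDK //; last 3 first.
- exact: measurableI.
- exact: measurableD.
- by apply/seteqP; split => // x [[? ?] []].
Qed.

Lemma le_pr A B : measurable A -> measurable B -> A `<=` B -> pr D A <= pr D B.
Proof.
move=> mA mB AB; rewrite (pr_setID mB mA) (_ : B `&` A = A); last exact/setIidPr.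
by rewrite lerDl pr_ge0.
Qed.

Lemma measurable_bool h : measurable_fun [set: n.-tuple R] h -> measurable [set x | h x].
Proof.
move=> mh; rewrite (_ : [set x | h x] = h @^-1` [set true]) //.
by rewrite -[X in measurable X]setTI; exact: mh.
Qed.

Lemma measurable_halfspace w t : measurable_fun [set: n.-tuple R] (halfspace w t).
Proof.
apply: measurable_fun_ler => //; apply: measurable_funB => //; exact: measurable_dot.
Qed.

Lemma errorE c h : measurable_fun [set: n.-tuple R] c -> measurable_fun [set: n.-tuple R] h ->
  error D h c = pr D [set x | h x] + pr D [set x | c x]
    - 2 * pr D ([set x | c x] `&` [set x | h x]).
Proof.
move=> /measurable_bool mc /measurable_bool mh.
rewrite /error (_ : [set x | h x != c x] =
  ([set x | h x] `\` [set x | c x]) `|` ([set x | c x] `\` [set x | h x])); last first.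
  apply/seteqP; split => x /=; case: (h x); case: (c x) => //=;
    by [left | right | case; case].
rewrite pr_setU; last 3 first.
- exact: measurableD.
- exact: measurableD.
- by apply/seteqP; split => // x [[? ?] []].
rewrite (pr_setID mh mc) (pr_setID mc mh) (setIC [set x | h x]); lra.
Qed.

Definition gap c h : R :=
  pr D ([set x | c x] `&` [set x | h x]) - pr D [set x | c x] * pr D [set x | h x].

Lemma unfairnessE c h : 0 < pr D [set x | h x] -> unfairness D c h = `|gap c h|.
Proof.
move=> h0; rewrite /unfairness /disparity /condpr /gap -[X in X * _]gtr0_norm //.
rewrite -normrM distrC; congr `|_|; field; exact: lt0r_neq0.
Qed.

Lemma gap_error c h : measurable_fun [set: n.-tuple R] c ->
  measurable_fun [set: n.-tuple R] h ->
  2 * gap c h = pr D [set x | h x] + pr D [set x | c x] - error D h c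
    - 2 * pr D [set x | c x] * pr D [set x | h x].
Proof. by move=> mc mh; rewrite errorE // /gap; lra. Qed.

(** Removing a set of mass p lowers P(c and h) by some q in [0, p] and P(c) P(h) by P(c) p, and q -
    P(c) p lies in [-p, p]. *)
Lemma gap_subset c h h' : measurable_fun [set: n.-tuple R] c ->
  measurable_fun [set: n.-tuple R] h -> measurable_fun [set: n.-tuple R] h' ->
  (forall x, h' x -> h x) ->
  `|gap c h - gap c h'| <= pr D [set x | h x] - pr D [set x | h' x].
Proof.
move=> mc mh mh' sub.
have mC := measurable_bool mc; have mH := measurable_bool mh; have mH' := measurable_bool mh'.
have E1 := pr_setID mH mH'.
have E2 := pr_setID (measurableI _ _ mC mH) mH'.
rewrite (_ : _ `&` _ = [set x | h' x]) in E1; last first.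
  by apply/seteqP; split => x /=; [case | move=> h'x; split => //; exact: sub].
rewrite (_ : _ `&` _ `&` _ = [set x | c x] `&` [set x | h' x]) in E2; last first.
  apply/seteqP; split => x /=; first by case=> -[].
  by case=> cx h'x; do !split => //; exact: sub.
have le : pr D (([set x | c x] `&` [set x | h x]) `\` [set x | h' x]) <=
    pr D ([set x | h x] `\` [set x | h' x]).
  apply: le_pr; [by apply: measurableD => //; exact: measurableI | exact: measurableD |].
  by move=> x /= [[]].
have q0 := pr_ge0 (([set x | c x] `&` [set x | h x]) `\` [set x | h' x]).
have C0 := pr_ge0 [set x | c x]; have C1 := pr_le1 mC.
have p0 := pr_ge0 ([set x | h x] `\` [set x | h' x]).
have Cp0 := mulr_ge0 C0 p0; have Cp1 := ler_piMl p0 C1.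
by rewrite /gap E1 E2 ler_norml; apply/andP; split; lra.
Qed.

(** * Thresholds and complements under continuous marginals *)

Section Continuous.
Hypothesis contD : continuous_marginals D.

Let below w t : R := pr D [set x | dot w x <= t].

Lemma measurable_dot_le w t : measurable [set x | dot w x <= t].
Proof.
rewrite (_ : [set x | _] = (fun x => dot w x <= t) @^-1` [set true]) //.
rewrite -[X in measurable X]setTI; exact: measurable_fun_ler.
Qed.

Lemma measurable_dot_eq w t : measurable [set x | dot w x = t].
Proof.
rewrite (_ : [set x | _] = (fun x => dot w x == t) @^-1` [set true]); last first.
  by apply/seteqP; split => x /eqP.
rewrite -[X in measurable X]setTI; exact: measurable_fun_eqr.
Qed.

Lemma belowE w : below w = fine \o cdf (dot w : {RV D >-> R}).
Proof.
apply/funext => t; rewrite /below /cdf /distribution /pushforward /pr /=.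
by congr (fine (D _)); apply/seteqP; split => x /=; rewrite in_itv.
Qed.

Lemma continuous_below w : nonzero w -> continuous (below w).
Proof.
move=> w0 t; rewrite belowE; apply: fine_cvg.
by rewrite fineK; [exact: contD | rewrite fin_num_measure].
Qed.

Lemma below_cvg1 w : below w t @[t --> +oo] --> (1 : R).
Proof. by rewrite belowE; apply: fine_cvg; exact: cvg_cdfy1. Qed.

(** For every u < t the hyperplane has mass at most [below w t - below w u], which tends to 0 as u
    tends to t. *)
Lemma pr_dot_eq0 w t : nonzero w -> pr D [set x | dot w x = t] = 0.
Proof.
move=> w0.
have meq := measurable_dot_eq w t.
have le u : u < t -> pr D [set x | dot w x = t] <= below w t - below w u.
  move=> ut; rewrite lerBrDl /below -pr_setU //; last 2 first.
  - exact: measurable_dot_le.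
  - by apply/seteqP; split => // x [/= le eq]; rewrite eq leNgt ut in le.
  apply: le_pr.
  - by apply: measurableU => //; exact: measurable_dot_le.
  - exact: measurable_dot_le.
  - by move=> x [/= le|/= ->//]; exact: le_trans (ltW ut).
apply/eqP; rewrite eq_le pr_ge0 andbT; apply/ler_addgt0Pr => e e0; rewrite add0r.
have /cvgrPdist_lt/(_ e e0)/nbhs_ballP[/= r r0 near_t] := continuous_below w0 (x := t).
have ut : t - r / 2 < t by lra.
apply: le_trans (le _ ut) _; apply: le_trans (ler_norm _) (ltW _).
by apply: near_t; rewrite /ball /= opprB addrC subrK gtr0_norm; lra.
Qed.

Lemma pr_halfspace w t : nonzero w -> pr D [set x | halfspace w t x] = 1 - below w t.
Proof.
move=> w0; have mle := measurable_dot_le w t.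
have mh := measurable_bool (measurable_halfspace w t).
have eq0 := pr_dot_eq0 t w0.
have : pr D [set x | halfspace w t x] =
    pr D ([set x | halfspace w t x] `&` [set x | dot w x <= t]) +
    pr D ([set x | halfspace w t x] `\` [set x | dot w x <= t]) by exact: pr_setID.
rewrite (_ : _ `&` _ = [set x | dot w x = t]); last first.
  apply/seteqP; split => x /=; rewrite /halfspace subr_ge0.
    by case=> ge le; apply/eqP; rewrite eq_le le.
  by move=> ->; rewrite lexx.
rewrite (_ : _ `\` _ = [set: n.-tuple R] `\` [set x | dot w x <= t]); last first.
  apply/seteqP; split => x /=; rewrite /halfspace subr_ge0; first by case.
  by case=> _ /negP; rewrite -ltNge => lt; split; [exact: ltW | apply/negP; rewrite -ltNge].
have := pr_setID (@measurableT _ (n.-tuple R)) mle.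
by rewrite setTI pr_setT eq0 /below; lra.
Qed.

(** Raising the threshold lowers the mass continuously towards 0. The intermediate value theorem is
    applied between [t] and a threshold [u] so large that less than [nu] is left. *)
Lemma halfspace_shrink w t nu : nonzero w -> 0 < nu <= pr D [set x | halfspace w t x] ->
  exists2 t', t <= t' & pr D [set x | halfspace w t' x] = nu.
Proof.
move=> w0 /andP[nu0 nule]; rewrite pr_halfspace // in nule.
have /cvgrPdist_lt/(_ nu nu0) [M [_ big]] := below_cvg1 w.
pose u := Num.max t (M + 1).
have tu : t <= u by rewrite le_max lexx.
have Mu : M < u by rewrite lt_max ltrDl ltr01 orbT.
have bu : 1 - nu < below w u.
  by have := big u Mu; rewrite ltr_norml => /andP[]; lra.
have [||t' + bt'] := IVT (f := below w) (v := 1 - nu) tu.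
- exact/continuous_subspaceT/continuous_below.
- by rewrite ge_min le_max; apply/andP; split; apply/orP; [left|right]; lra.
rewrite in_itv /= => /andP[tt' _]; exists t' => //.
by rewrite pr_halfspace // bt'; lra.
Qed.

(** As sgn 0 = +1, both halfspaces contain the boundary; the complement is exact only off the
    hyperplane, which is a null set. *)
Lemma halfspaceN w t x : dot w x != t ->
  halfspace [tuple of [seq - y | y <- w]] (- t) x = ~~ halfspace w t x.
Proof.
have dotN : dot [tuple of [seq - y | y <- w]] x = - dot w x.
  by rewrite /dot -sumrN; apply: eq_bigr => j _; rewrite tnth_map mulNr.
rewrite /halfspace dotN opprK addrC subr_ge0 subr_ge0 -ltNge => neq.
by rewrite lt_neqAle neq.
Qed.

Lemma nonzeroN w : nonzero w -> nonzero [tuple of [seq - y | y <- w]].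
Proof. by case=> j wj; exists j; rewrite tnth_map oppr_eq0. Qed.

Lemma pr_eq_off w t A B : nonzero w -> measurable A -> measurable B ->
  (forall x, dot w x != t -> A x <-> B x) -> pr D A = pr D B.
Proof.
move=> w0 + + AB.
wlog suff le : A B AB / measurable A -> measurable B -> pr D A <= pr D B.
  move=> mA mB; apply/eqP; rewrite eq_le !le // => x /AB; tauto.
move=> mA mB.
have meq := measurable_dot_eq w t.
rewrite (pr_setID mA meq).
have -> : pr D (A `&` [set x | dot w x = t]) = 0.
  apply/eqP; rewrite eq_le pr_ge0 andbT -[leRHS](pr_dot_eq0 t w0).
  by apply: le_pr => //; exact: measurableI.
rewrite add0r; apply: le_pr => // [|x [Ax /= /eqP neq]]; last exact/AB.
exact: measurableD.
Qed.

Lemma pr_halfspaceN w t : nonzero w ->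
  pr D [set x | halfspace [tuple of [seq - y | y <- w]] (- t) x] =
  1 - pr D [set x | halfspace w t x].
Proof.
move=> w0; have mh := measurable_bool (measurable_halfspace w t).
have mhN := measurable_bool (measurable_halfspace [tuple of [seq - y | y <- w]] (- t)).
rewrite (@pr_eq_off w t _ ([set: n.-tuple R] `\` [set x | halfspace w t x])) //.
- have := pr_setID (@measurableT _ (n.-tuple R)) mh.
  by rewrite setTI pr_setT; lra.
- exact: measurableD.
- move=> x neq /=; rewrite halfspaceN //; split; last by case=> _ /negP.
  by move/negP.
Qed.

Lemma gapN c w t : measurable_fun [set: n.-tuple R] c -> nonzero w ->
  gap c (halfspace [tuple of [seq - y | y <- w]] (- t)) = - gap c (halfspace w t).
Proof.
move=> mc w0; rewrite /gap pr_halfspaceN //.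
have mh := measurable_bool (measurable_halfspace w t); have mC := measurable_bool mc.
have mhN := measurable_bool (measurable_halfspace [tuple of [seq - y | y <- w]] (- t)).
rewrite (@pr_eq_off w t (_ `&` _) ([set x | c x] `\` [set x | halfspace w t x])) //.
- by have := pr_setID mC mh; lra.
- exact: measurableI.
- exact: measurableD.
- move=> x neq /=; rewrite halfspaceN //; split; case=> cx /negP //.
Qed.

End Continuous.
End Halfspaces.

(** * Trees that represent halfspaces *)

Section TreeHalfspace.
Context (R : realType) (n : nat).
Implicit Types (u : tree R) (w x : n.-tuple R) (xs : seq R).

(** Decoding is defined for all trees, because the test bound is integrated over all training
    samples, including those on which the learner fails. *)
Definition tree_vec u : n.-tuple R := [tuple num (head (iter i (@tail R) (head u))) | i < n].
Definition tree_threshold u : R := num (tail u).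
Definition tree_halfspace u := halfspace (tree_vec u) (tree_threshold u).

Lemma dot_treeE acc u xs :
  dot_tree acc u xs =
  acc + \sum_(i < size xs) num (head (iter i (@tail R) u)) * xs`_i.
Proof.
elim: xs acc u => [|x xs IH] acc u /=; first by rewrite big_ord0 addr0.
rewrite IH big_ord_recl /= addrA; congr (_ + _); apply: eq_bigr => i _.
by rewrite -iterSr.
Qed.

Lemma halfspace_treeE u x : halfspace_tree u x = tree_halfspace u x.
Proof.
rewrite /halfspace_tree dot_treeE /tree_halfspace /halfspace addrC /dot size_tuple.
congr (0 <= _ - _); apply: eq_bigr => i _.
by rewrite tnth_mktuple (tnth_nth 0).
Qed.

Lemma iter_tail_of_seq (us : seq (tree R)) i :
  head (iter i (@tail R) (of_seq us)) = nth Nil us i.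
Proof.
have iterN j : iter j (@tail R) Nil = Nil by elim: j => //= j ->.
elim: us i => [|u us IH] [|i] //=; first by rewrite iterN.
by rewrite -IH -iterS iterSr.
Qed.

Lemma tree_vecK w t : tree_vec (of_halfspace w t) = w.
Proof.
apply: eq_from_tnth => i.
rewrite tnth_mktuple /= iter_tail_of_seq (nth_map 0) ?size_tuple //=.
by rewrite (tnth_nth 0).
Qed.

Lemma tree_halfspaceK w t : tree_halfspace (of_halfspace w t) = halfspace w t.
Proof. by rewrite /tree_halfspace tree_vecK. Qed.

Lemma map_rev_of_seq f (vs us : seq (tree R)) xs : size us = size xs ->
  map_rev f (of_seq vs) (of_seq us) xs = of_seq (catrev (map f us) vs).
Proof.
elim: us xs vs => [|u us IH] [|x xs] vs //= [sz].
exact: (IH xs (f u :: vs)).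
Qed.

Lemma complement_treeK w t xs : size xs = n ->
  complement_tree (of_halfspace w t) xs =
  of_halfspace [tuple of [seq - y | y <- w]] (- t).
Proof.
move=> sz; rewrite /complement_tree /of_halfspace /= /of_vec.
rewrite -/(of_seq [::]) (map_rev_of_seq _ [::]) ?size_map ?size_tuple //.
rewrite (map_rev_of_seq _ [::]) ?size_map -?/(rev _) ?size_rev ?size_map ?size_tuple //.
by rewrite -!/(rev _) map_id revK -!map_comp.
Qed.

(** This allows the clock, in the program a test point, to be replaced by a constant list. The
    candidate then depends on the training sample alone, as the independence argument requires. *)
Lemma complement_tree_size u xs ys : size xs = size ys ->
  complement_tree u xs = complement_tree u ys.
Proof.
have E f acc v xs' ys' : size xs' = size ys' ->
    map_rev f acc v xs' = map_rev f acc v ys'.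
  by elim: xs' ys' acc v => [|x xs' IH] [|y ys'] acc v //= [/IH].
by move=> sz; rewrite /complement_tree !(E _ _ _ _ _ sz).
Qed.

Definition excess (c h : n.-tuple R -> bool) (mu : R) x : R :=
  if c x then (if h x then 1 else 0) - mu else 0.

Lemma score_excess u mu (c : n.-tuple R -> bool) (s : seq (n.-tuple R)) :
  score u mu (rev [seq (x : seq R, c x) | x <- s]) =
  \sum_(x <- s) excess c (tree_halfspace u) mu x.
Proof.
have E acc (ts : seq (seq R * bool)) : foldl (score_step u mu) acc ts =
    acc + \sum_(xb <- ts) score_step u mu 0 xb.
  elim: ts acc => [|xb ts IH] acc /=; first by rewrite big_nil addr0.
  rewrite IH big_cons addrA; congr (_ + _).
  by rewrite /score_step; case: xb.2; rewrite ?addr0 ?add0r.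
rewrite /score E add0r (perm_big _ (permEl (perm_rev _))) big_map /=.
apply: eq_bigr => x _; rewrite /score_step /excess /= halfspace_treeE.
by case: (c x); rewrite ?add0r.
Qed.

Lemma labeled_sampleE m (s : m.-tuple (n.-tuple R)) (c : n.-tuple R -> bool) :
  labeled_sample s c = of_seq (map (@example R) [seq (x : seq R, c x) | x <- s]).
Proof. by rewrite -map_comp. Qed.

(** * Measurability of decoded and complemented halfspaces *)

Section Measurable.
Context d (T : measurableType d).
Implicit Type f : T -> tree R.

Lemma tree_measurable_iter_tail f i : tree_measurable f ->
  tree_measurable (fun s => iter i (@tail R) (f s)).
Proof. by elim: i => // i IH /IH; exact: tree_measurable_tail. Qed.

Lemma measurable_tree_vec f : tree_measurable f ->
  measurable_fun [set: T] (fun s => tree_vec (f s)).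
Proof.
move=> mf; apply/measurable_fun_tnthP => i.
rewrite (_ : _ \o _ = fun s => num (head (iter i (@tail R) (head (f s))))).
  exact/tree_measurable_num/tree_measurable_head/tree_measurable_iter_tail/tree_measurable_head.
by apply/funext => s /=; rewrite tnth_mktuple.
Qed.

Lemma measurable_tree_halfspace f : tree_measurable f ->
  measurable_fun [set: T * n.-tuple R] (fun z => tree_halfspace (f z.1) z.2).
Proof.
move=> mf; apply: measurable_fun_ler => //; apply: measurable_funB; last first.
  apply: (measurableT_comp (f := fun s => num (tail (f s)))); last exact: measurable_fst.
  exact/tree_measurable_num/tree_measurable_tail.
apply: measurable_sum => j; apply: measurable_funM.
  apply: (measurableT_comp (f := fun s => tnth (tree_vec (f s)) j)); last exact: measurable_fst.
  exact: (measurableT_comp (measurable_tnth j) (measurable_tree_vec mf)).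
exact: (measurableT_comp (measurable_tnth j) measurable_snd).
Qed.

Lemma tree_measurable_map_rev g f1 f2 xs :
  (forall f, tree_measurable f -> tree_measurable (fun s : T => g (f s))) ->
  tree_measurable f1 -> tree_measurable f2 ->
  tree_measurable (fun s => map_rev g (f1 s) (f2 s) xs).
Proof.
move=> mg; elim: xs f1 f2 => //= x xs IH f1 f2 mf1 mf2.
apply: IH; last exact: tree_measurable_tail.
by apply: tree_measurable_Cons => //; exact/mg/tree_measurable_head.
Qed.

Lemma tree_measurable_neg f : tree_measurable f ->
  tree_measurable (fun s => neg_tree (f s)).
Proof.
move=> mf; apply: tree_measurable_Num; apply: measurableT_comp => //.
exact: tree_measurable_num.
Qed.

Lemma tree_measurable_complement f xs : tree_measurable f ->
  tree_measurable (fun s => complement_tree (f s) xs).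
Proof.
move=> mf; apply: tree_measurable_Cons.
  have mNil : tree_measurable (fun _ : T => Nil : tree R) by exact: tree_measurable_Nil.
  apply: (tree_measurable_map_rev (f1 := fun=> Nil)) => //.
  apply: (tree_measurable_map_rev (f1 := fun=> Nil)) => //; first exact: tree_measurable_neg.
  exact: tree_measurable_head.
exact/tree_measurable_neg/tree_measurable_tail.
Qed.

End Measurable.

Lemma tree_measurable_sample m (c : n.-tuple R -> bool) :
  measurable_fun [set: n.-tuple R] c ->
  tree_measurable (fun s : m.-tuple (n.-tuple R) => labeled_sample s c).
Proof.
move=> mc.
have mx : tree_measurable (fun x : n.-tuple R => Cons (of_vec x) (of_label R (c x))).
  apply: tree_measurable_Cons; last first.
    by apply: tree_measurable_Num; apply: measurable_fun_ifT.
  (* A list of fixed length is rewritten as a fixed list of functions, one for each index; the same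
     is done below for the sample. *)
  rewrite (_ : @of_vec R n = fun x : n.-tuple R =>
    of_seq [seq f x | f <- [seq (fun x : n.-tuple R => Num (tnth x i)) | i <- enum 'I_n]]).
    apply: tree_measurable_of_seq => i.
    have [lti|gei] := ltnP i n; last first.
      rewrite nth_default; last by rewrite !size_map -enumT size_enum_ord.
      exact: tree_measurable_Nil.
    rewrite (nth_map (Ordinal lti)); last by rewrite size_enum_ord.
    by apply: tree_measurable_Num; exact: measurable_tnth.
  apply/funext => x; rewrite /of_vec -map_comp.
  by rewrite -[in LHS](map_tnth_enum x) -map_comp.
rewrite (_ : (fun s => _) = fun s : m.-tuple (n.-tuple R) =>
    of_seq [seq f s | f <- [seq (fun s : m.-tuple (n.-tuple R) =>
      Cons (of_vec (tnth s i)) (of_label R (c (tnth s i)))) | i <- enum 'I_m]]).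
  apply: tree_measurable_of_seq => i.
  have [lti|gei] := ltnP i m; last first.
    rewrite nth_default; last by rewrite !size_map -enumT size_enum_ord.
    exact: tree_measurable_Nil.
  rewrite (nth_map (Ordinal lti)); last by rewrite size_enum_ord.
    move=> path.
  have [m1 m2] := mx path.
  split.
    exact: (measurableT_comp m1 (measurable_tnth _)).
  exact: (measurableT_comp m2 (measurable_tnth _)).
apply/funext => s; rewrite /labeled_sample -map_comp.
by rewrite -[in LHS](map_tnth_enum s) -map_comp.
Qed.

(** * The mean of the test statistic *)

Section Excess.
Variables (D : probability (n.-tuple R) R) (c : n.-tuple R -> bool).
Hypothesis mc : measurable_fun [set: n.-tuple R] c.

Lemma excess_le1 h mu x : 0 <= mu <= 1 -> `|excess c h mu x| <= 1.
Proof. by rewrite /excess ler_norml; case: (c x); case: (h x); lra. Qed.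

Lemma integral_excess h mu : measurable_fun [set: n.-tuple R] h ->
  (\int[D]_x (excess c h mu x)%:E =
   (pr D ([set x | c x] `&` [set x | h x]) - mu * pr D [set x | c x])%:E)%E.
Proof.
move=> mh; have mC := measurable_bool mc; have mH := measurable_bool mh.
have mCH := measurableI _ _ mC mH.
rewrite (eq_integral (fun x => (\1_([set x | c x] `&` [set x | h x]) x)%:E +
   (- mu)%:E * (\1_[set x | c x] x)%:E)%E); last first.
  move=> x _; rewrite /excess !indicE in_setI -EFinM -EFinD; congr EFin.
  rewrite -[x \in [set x | c x]]/(`[< c x >]) -[x \in [set x | h x]]/(`[< h x >]).
  rewrite !asboolb; case: (c x); case: (h x) => /=; rewrite ?mulr1n ?mulr0n; lra.
have i1 A : measurable A -> D.-integrable [set: n.-tuple R] (EFin \o \1_A).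
  move=> mA; apply: (integrable_bounded1 D); first exact: measurable_indic.
  by move=> x; rewrite indicE; case: (_ \in _); rewrite ?normr1 ?normr0 // ler01.
have iE A : measurable A -> (\int[D]_x (\1_A x)%:E = (pr D A)%:E)%E.
  by move=> mA; rewrite integral_indic // setIT; exact: EFin_pr.
rewrite integralD //=; last 2 first.
- exact: i1.
- by apply: integrableZl => //; exact: i1.
rewrite integralZl //; last exact: i1.
rewrite !iE // -EFinM -EFinD; congr EFin; lra.
Qed.

End Excess.
End TreeHalfspace.

(** * Numbers of samples and of steps *)

Section Budget.
Context (R : realType).

(** [T] is the least exponent for which the product exceeds 1. Minimality gives
    [(1 + x) ^+ (T - 1) * dl <= 1]; taking logarithms, with [x / 2 <= ln (1 + x)], bounds [T]. *)
Lemma sample_count (x dl : R) : 0 < x <= 1 -> 0 < dl < 1 -> exists T : nat,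
  [/\ (0 < T)%N, forall j, (j < T)%N -> (1 + x) ^+ j * dl <= 1,
      1 < (1 + x) ^+ T * dl & T%:R <= 1 + 2 / x * ln dl^-1].
Proof.
move=> /andP[x0 x1] /andP[dl0 dl1].
(* [ln y <= y - 1] at y = 1/(1 + x), together with 1/(1 + x) <= 1 - x/2 for x in (0, 1]. *)
have ln1x : x / 2 <= ln (1 + x).
  have x1p : 0 < 1 + x by lra.
  have ix : (1 + x)^-1 <= 1 - x / 2 by rewrite -[leLHS]mul1r ler_pdivrMr //; nra.
  have ix0 : 0 < (1 + x)^-1 by rewrite invr_gt0.
  have ln_le : ln (1 + ((1 + x)^-1 - 1)) <= (1 + x)^-1 - 1 by apply: le_ln1Dx; lra.
  by rewrite addrC subrK lnV ?posrE // in ln_le; lra.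
(* Bernoulli's inequality: any j above 1/(dl x) will do. *)
have ex : exists j, 1 < (1 + x) ^+ j * dl.
  pose M := dl^-1 / x.
  have M0 : 0 <= M by rewrite divr_ge0 ?invr_ge0 ?ltW.
  exists (Num.trunc M).+1.
  have geM : M < (Num.trunc M).+1%:R by exact: truncnS_gt.
  have bern j : 1 + j%:R * x <= (1 + x) ^+ j.
    elim: j => [|j IH]; first by rewrite mul0r addr0 expr0.
    rewrite exprS -natr1; have j0 : 0 <= j%:R :> R by exact: ler0n.
    have : (1 + x) * (1 + j%:R * x) <= (1 + x) * (1 + x) ^+ j by rewrite ler_wpM2l //; lra.
    have : 0 <= j%:R * x * x by rewrite !mulr_ge0 // ltW.
    lra.
  rewrite -ltr_pdivrMr // div1r; apply: lt_le_trans (bern _).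
  have -> : dl^-1 = M * x by rewrite /M -mulrA mulVf ?mulr1 // gt_eqF.
  have : M * x < (Num.trunc M).+1%:R * x by rewrite ltr_pM2r.
  lra.
have [T large minT] := ex_minnP ex.
exists T; split => //.
- case: T large {minT} => //; rewrite expr0 mul1r; lra.
- by move=> j; rewrite leNgt; apply: contraTN => /minT; rewrite -leqNgt.
- case: T large minT => [|T] large minT; first by move: large; rewrite expr0 mul1r; lra.
  rewrite -natr1 addrC lerD2l.
  have le : (1 + x) ^+ T * dl <= 1.
    by rewrite leNgt; apply/negP => /minT; rewrite ltnn.
  have x1p : 0 < 1 + x by lra.
  have : ln ((1 + x) ^+ T * dl) <= ln 1.
    by rewrite ler_ln ?posrE // mulr_gt0 // exprn_gt0.
  rewrite ln1 lnM ?posrE ?exprn_gt0 // lnXn // lnV ?posrE // -[_ *+ T]mulr_natl => le0.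
  have : T%:R * (x / 2) <= T%:R * ln (1 + x) by rewrite ler_wpM2l // ler0n.
  move=> le1; have le2 : T%:R * (x / 2) <= - ln dl by lra.
  have := ler_wpM2l (ltW (divr_gt0 (ltr0n R 2) x0)) le2.
  have -> : 2 / x * (T%:R * (x / 2)) = T%:R by field; exact: lt0r_neq0.
  by [].
Qed.

Lemma grid_count (a b e : R) : 0 < a -> a <= b -> b < 1 -> 0 < e -> exists K : nat,
  [/\ (0 < K)%N, forall j, (j < K)%N -> a + j%:R * e <= b, b < a + K%:R * e &
      K%:R <= 1 + e^-1].
Proof.
move=> a0 ab b1 e0; pose M := (b - a) / e.
have M0 : 0 <= M by rewrite divr_ge0 ?subr_ge0 // ltW.
have Me : M * e = b - a by rewrite /M -mulrA mulVf ?mulr1 // gt_eqF.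
have leM : (Num.trunc M)%:R <= M by rewrite truncn_le.
exists (Num.trunc M).+1; split => //.
- move=> j; rewrite ltnS => le.
  have : j%:R * e <= M * e by rewrite ler_pM2r // (le_trans _ leM) // ler_nat.
  by rewrite Me; lra.
- have : M * e < (Num.trunc M).+1%:R * e by rewrite ltr_pM2r //; exact: truncnS_gt.
  by rewrite Me; lra.
- rewrite -natr1 addrC lerD2l; apply: le_trans leM _.
  by rewrite /M -[leRHS]mul1r ler_pM2r ?invr_gt0 //; lra.
Qed.

(** Here Q is n + 1/eps + log(1/delta). The product kk T n has degree 1 + 3 + 1 = 5 and kk t has
    degree k + 1, so the exponent k + 5 covers both. After kk <= 5 Q the coefficients add up to 10 =
    2 * 5, 6600 = 600 + 5000 + 1000 and 2800 = 500 + 2000 + 300. *)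
Lemma auditor_time_le (kk t n T c1 c3 Q : R) (k : nat) :
  1 <= Q -> 0 <= c1 -> 0 <= c3 -> 0 <= kk -> 0 <= t -> 0 <= n -> 0 <= T ->
  kk <= 5 * Q -> t <= c1 * Q ^+ k -> n <= Q -> T <= c3 * Q ^+ 3 ->
  kk * (2 * t + 120 * n + 2 * (T * (50 * n + 200)) + 1000) + 300 * T + 1000 <=
  (10 * c1 + 6600 + 2800 * c3) * Q ^+ (k + 5).
Proof.
move=> Q1 c10 c30 kk0 t0 n0 T0 kQ tQ nQ TQ.
have Q0 : 0 <= Q by lra.
have lek i : (i <= 5)%N -> (i <= k + 5)%N by move=> le; rewrite (leq_trans le) // leq_addl.
have [P PE] : exists P, P = Q ^+ (k + 5) by eexists.
rewrite -PE; have leP i : (i <= k + 5)%N -> Q ^+ i <= P.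
  by move=> le; rewrite PE ler_weXn2l.
have P1 : 1 <= P := leP 0%N isT.
have Qi i : 0 <= Q ^+ i by exact: exprn_ge0.
have c3P i : (i <= k + 5)%N -> c3 * Q ^+ i <= c3 * P by move=> /leP; exact: ler_wpM2l.
have c1P i : (i <= k + 5)%N -> c1 * Q ^+ i <= c1 * P by move=> /leP; exact: ler_wpM2l.
have kt : kk * t <= 5 * (c1 * P).
  apply: le_trans (_ : 5 * Q * (c1 * Q ^+ k) <= _); first by rewrite ler_pM.
  have -> : 5 * Q * (c1 * Q ^+ k) = 5 * (c1 * Q ^+ k.+1) by rewrite exprS; ring.
  by rewrite ler_wpM2l // c1P // -addn1 leq_add2l.
have kn : kk * n <= 5 * P.
  apply: le_trans (_ : 5 * Q * Q <= _); first by rewrite ler_pM.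
  by rewrite -mulrA -expr2 ler_wpM2l // leP // lek.
have kT : kk * T <= 5 * (c3 * P).
  apply: le_trans (_ : 5 * Q * (c3 * Q ^+ 3) <= _); first by rewrite ler_pM.
  have -> : 5 * Q * (c3 * Q ^+ 3) = 5 * (c3 * Q ^+ 4) by ring.
  by rewrite ler_wpM2l // c3P // lek.
have kTn : kk * T * n <= 5 * (c3 * P).
  apply: le_trans (_ : 5 * Q * (c3 * Q ^+ 3) * Q <= _).
    by rewrite ler_pM // ?mulr_ge0 // ler_pM.
  have -> : 5 * Q * (c3 * Q ^+ 3) * Q = 5 * (c3 * Q ^+ 5) by ring.
  by rewrite ler_wpM2l // c3P // lek.
have kP : kk <= 5 * P.
  by apply: le_trans kQ _; rewrite ler_wpM2l // -[leLHS]expr1 leP // lek.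
have TP : T <= c3 * P by apply: le_trans TQ _; rewrite c3P // lek.
move: kt kn kT kTn kP TP P1; clear; lra.
Qed.

(** The factor 4 * 12 = 48 and 1/eps enter 1/dl as factors; their logarithms are bounded by the
    numbers themselves. *)
Lemma ln_inv_budget (eps delta : R) : 0 < eps -> 0 < delta ->
  ln (delta * (eps / 4) / 12)^-1 <= ln delta^-1 + eps^-1 + 48.
Proof.
move=> eps0 delta0.
have -> : (delta * (eps / 4) / 12)^-1 = delta^-1 * (eps^-1 * 48).
  by field; rewrite !gt_eqF.
rewrite lnM ?posrE ?invr_gt0 ?mulr_gt0 ?invr_gt0 // lnM ?posrE ?invr_gt0 //.
have le1 : ln eps^-1 < eps^-1 by rewrite ln_sublinear ?invr_gt0.
have le2 : ln (48 : R) < 48 by rewrite ln_sublinear.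
by move: le1 le2; clear; lra.
Qed.

(** Passing from (eps, delta) to (e, dl) enlarges the base of the budget by a factor at most 60,
    whence [c1]; [c3] bounds T, which grows like log(1/dl) / eps^2. The second inequality makes the
    list long enough for T test examples and the learner's own demand. *)
Lemma auditor_budget (C k : nat) : exists C' : nat,
  forall (n tau T K : nat) (eps delta : R), 0 < eps < 1 -> 0 < delta < 1 ->
  let e := eps / 4 in
  let dl := delta * e / 12 in
  tau%:R <= budget C k n e dl ->
  T%:R <= 1 + 2 / (e * e / 32) * ln dl^-1 ->
  K%:R <= 1 + e^-1 ->
  (K * (2 * tau + 120 * n + 2 * (T * (50 * n + 200)) + 1000) + 300 * T + 1000)%:R
    <= budget C' (k + 5) n eps delta /\
  T%:R + budget C k n e dl <= budget C' (k + 5) n eps delta.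
Proof.
have [c1 c1E] : exists c1 : R, c1 = C%:R * 60 ^+ k by eexists.
have [c3 c3E] : exists c3 : R, c3 = 1 + 2 * 32 * 16 * 60 by eexists.
have [A AE] : exists A : R, A = 10 * c1 + 6600 + 2800 * c3 by eexists.
have c10 : 0 <= c1 by rewrite c1E mulr_ge0 ?ler0n ?exprn_ge0.
have c30 : 0 <= c3 by rewrite c3E; lra.
have A0 : 0 <= A by rewrite AE; lra.
exists (Num.trunc A).+1 => n tau T K eps delta /andP[eps0 eps1] /andP[delta0 delta1] e dl.
have AC : A <= (Num.trunc A).+1%:R by apply/ltW/truncnS_gt.
have [Q QE] : exists Q : R, Q = n%:R + eps^-1 + ln delta^-1 by eexists.
have n0 : 0 <= n%:R :> R by exact: ler0n.
have ieps1 : 1 <= eps^-1 by rewrite invf_ge1 // ltW.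
have lnd0 : 0 <= ln delta^-1 by rewrite ln_ge0 // invf_ge1 // ltW.
have [Q1 nQ epsQ] : [/\ 1 <= Q, n%:R <= Q & eps^-1 <= Q].
  by move: QE n0 ieps1 lnd0; clear => *; split; lra.
have Q0 : 0 <= Q by exact: le_trans Q1.
have e0 : 0 < e by rewrite divr_gt0.
have ie : e^-1 = 4 * eps^-1 by rewrite /e invfM invrK mulrC.
have lndl : ln dl^-1 <= ln delta^-1 + eps^-1 + 48 by exact: ln_inv_budget.
have dl0 : 0 < dl by rewrite !divr_gt0 // mulr_gt0.
have e1 : e <= 1 by move: eps1; rewrite /e; clear; lra.
have dl1 : dl <= 1.
  have : delta * e <= 1 * 1 by rewrite ler_pM // ltW.
  by rewrite /dl ler_pdivrMr // mul1r; clear; lra.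
have lndl0 : 0 <= ln dl^-1 by rewrite ln_ge0 // invf_ge1.
have lnQ : ln dl^-1 <= 60 * Q.
  by move: lndl Q1 QE n0 lnd0 ieps1; move: (ln dl^-1) => l; clear; lra.
have bud : budget C k n e dl <= c1 * Q ^+ k.
  rewrite /budget c1E -mulrA -exprMn ler_wpM2l ?ler0n // lerXn2r ?nnegrE //.
  - by rewrite !addr_ge0 // invr_ge0 ltW.
  - by rewrite mulr_ge0.
  - by rewrite ie; move: lndl Q1 QE n0 lnd0 ieps1; move: (ln dl^-1) => l; clear; lra.
move=> tau_le T_le K_le.
have KQ : K%:R <= 5 * Q.
  by rewrite ie in K_le; move: K_le epsQ Q1; clear; lra.
have TQ : T%:R <= c3 * Q ^+ 3.
  apply: le_trans T_le _.
  have -> : 2 / (e * e / 32) = 2 * 32 * 16 * (eps^-1 ^+ 2).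
    by rewrite /e; field; rewrite gt_eqF.
  have sq : eps^-1 ^+ 2 <= Q ^+ 2 by rewrite lerXn2r ?nnegrE ?invr_ge0 ?(ltW eps0).
  have le1 : eps^-1 ^+ 2 * ln dl^-1 <= Q ^+ 2 * (60 * Q) by rewrite ler_pM // sqr_ge0.
  have le2 : 1 <= Q ^+ 3 by rewrite exprn_ege1.
  by rewrite c3E; move: le1 le2; rewrite [Q ^+ 3]exprSr; clear; lra.
have budE : budget (Num.trunc A).+1 (k + 5) n eps delta =
  (Num.trunc A).+1%:R * Q ^+ (k + 5) by rewrite QE.
have AP : A * Q ^+ (k + 5) <= (Num.trunc A).+1%:R * Q ^+ (k + 5).
  by rewrite ler_wpM2r // exprn_ge0.
rewrite budE; split; apply: le_trans AP.
  rewrite AE.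
  apply: le_trans (auditor_time_le Q1 c10 c30 _ _ _ _ KQ (le_trans tau_le bud) nQ TQ) => //.
  by rewrite !(natrD, natrM).
have lek i : (i <= 5)%N -> (i <= k + 5)%N by move=> le; rewrite (leq_trans le) // leq_addl.
have leP i : (i <= k + 5)%N -> Q ^+ i <= Q ^+ (k + 5) by move=> le; rewrite ler_weXn2l.
have le1 : c3 * Q ^+ 3 <= c3 * Q ^+ (k + 5) by rewrite ler_wpM2l // leP // lek.
have le2 : c1 * Q ^+ k <= c1 * Q ^+ (k + 5) by rewrite ler_wpM2l // leP // leq_addr.
have P0 : 0 <= Q ^+ (k + 5) by exact: exprn_ge0.
have c1P0 := mulr_ge0 c10 P0; have c3P0 := mulr_ge0 c30 P0.
by rewrite AE; move: le1 le2 TQ bud P0 c1P0 c3P0; clear; lra.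
Qed.

End Budget.

(** * Correctness of the auditor *)

Section UnionBound.
Context d (T : measurableType d) (R : realType) (P : probability T R).

Lemma measure_setU_le (A B : set T) (x y : R) : measurable A -> measurable B ->
  (P A <= x%:E)%E -> (P B <= y%:E)%E -> (P (A `|` B) <= (x + y)%:E)%E.
Proof.
move=> mA mB Ax By; apply: le_trans (measureU2 P mA mB) _.
by rewrite EFinD; exact: leeD.
Qed.

(** The conclusion supplies a measurable good event instead of a bound on a union, which is the form
    that [prob_at_least] asks for. *)
Lemma union_bound (B : nat -> set T) (r : R) N :
  (forall i, (i < N)%N -> measurable (B i)) ->
  (forall i, (i < N)%N -> (P (B i) <= r%:E)%E) ->
  exists F, [/\ measurable F, ((1 - N%:R * r)%:E <= P F)%E &
    forall i s, (i < N)%N -> F s -> ~ B i s].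
Proof.
elim: N => [|N IH] mB Br.
  by exists setT; split => //; rewrite mul0r subr0 probability_setT.
have [i ltiN|i ltiN|F [mF leF disj]] := IH; [exact/mB/ltnW | exact/Br/ltnW |].
have mBN := mB N (ltnSn N); have BrN := Br N (ltnSn N).
exists (F `\` B N); split.
- exact: measurableD.
- have E : P F = (P (F `\` B N) + P (F `&` B N))%E by exact: measureDI.
  have fF : P F \is a fin_num by exact: fin_num_measure.
  have fD : P (F `\` B N) \is a fin_num by apply: fin_num_measure => //; exact: measurableD.
  have mI : measurable (F `&` B N) by exact: measurableI.
  have fI : P (F `&` B N) \is a fin_num by exact: fin_num_measure.
  have : (P (F `&` B N) <= r%:E)%E.
    by apply: le_trans BrN; apply: le_measure; rewrite ?inE // => x [].
  move: (P F) (P (F `\` B N)) (P (F `&` B N)) E fF fD fI leF.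
  move=> [x| |] [y| |] [z| |] //; rewrite -EFinD => -[->] _ _ _; rewrite !lee_fin -natr1.
  by clear; lra.
- move=> i s; rewrite ltnS leq_eqVlt => /orP[/eqP ->|lti] [Fs nB] //.
  exact: disj.
Qed.

End UnionBound.

Section Audit.
Context (R : realType) (B : primitives R) (n : nat).
Variables (D : probability (n.-tuple R) R) (c : n.-tuple R -> bool).
Hypothesis mc : measurable_fun [set: n.-tuple R] c.
Hypothesis contD : continuous_marginals D.

(** A successful output is a halfspace as a function, which says nothing about the particular normal
    vector that was printed. With [w = 0] the function is constant and its mass is 0 or 1. *)
Lemma nonzero_mass w t : 0 < pr D [set x | halfspace w t x] < 1 -> nonzero w.
Proof.
move=> mass; apply: contrapT => /forallNP zero.
have E x : halfspace w t x = (0 <= - t).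
  rewrite /halfspace /dot big1 ?add0r // => j _.
  by have /negP := zero j; rewrite negbK => /eqP ->; rewrite mul0r.
have [t0|t0] := boolP (0 <= - t).
  have ET : [set x | halfspace w t x] = setT.
    by apply/seteqP; split => // x _ /=; rewrite E.
  by move: mass; rewrite ET pr_setT ltxx andbF.
have E0 : [set x | halfspace w t x] = set0.
  by apply/seteqP; split => // x /=; rewrite E (negbTE t0).
by move: mass; rewrite E0 /pr measure0 ltxx.
Qed.

(** At a fixed mass, 2 gap + error is constant, so an error within [e] of the optimum is a gap
    within [e / 2]. *)
Lemma gap_near_optimal h h' mu e : halfspaces_of_mass D mu h ->
  error D h c <= inf [set error D g c | g in halfspaces_of_mass D mu] + e ->
  halfspaces_of_mass D mu h' -> gap D c h' - e / 2 <= gap D c h.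
Proof.
move=> mass_h opt mass_h'.
have le : inf [set error D g c | g in halfspaces_of_mass D mu] <= error D h' c.
  apply: ge_inf; last by exists h'.
  by exists 0 => _ [g _ <-]; exact: pr_ge0.
case: mass_h opt => -[w [t [_ ->]]] mh opt.
case: mass_h' le => -[w' [t' [_ ->]]] mh' le.
have E := gap_error D mc (measurable_halfspace w t).
have E' := gap_error D mc (measurable_halfspace w' t').
by rewrite mh in E; rewrite mh' in E'; move: E E' opt le; clear; lra.
Qed.

(** |g| <= |x|/t + e <= |x'|/t + e <= |g'| + 2e. *)
Lemma compare_estimates (t g g' x x' e : R) : 0 < t ->
  `|x - t * g| <= t * e -> `|x' - t * g'| <= t * e -> `|x| <= `|x'| ->
  `|g| - 2 * e <= `|g'|.
Proof.
move=> t0 dx dx' le.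
have h1 := lerB_dist (t * g) x; rewrite distrC in h1.
have h2 := lerB_dist x' (t * g').
rewrite !normrM gtr0_norm // in h1 h2.
rewrite -(ler_pM2l t0) mulrBr.
have -> : t * (2 * e) = t * e + t * e by ring.
by move: dx dx' le h1 h2; clear; lra.
Qed.

(** * Candidates computed from a training sample *)

Section Run.
Variables (p : prog B) (e dl beta : R) (m T : nat).

Definition learning_input mu (s : m.-tuple (n.-tuple R)) : tree R :=
  of_seq [:: Num n%:R; Num mu; Num e; Num dl; labeled_sample s c].

(** The cut-off is the learner's time bound, so no loop of an actual run is cut short. *)
Definition learned mu s := eval (Num.trunc beta) p (learning_input mu s).

(* [nseq n 0] is the clock of [complement_tree]; only its length matters. *)
Definition learned_candidate (mu : R) (side : bool) s : tree R :=
  if side then learned mu s else complement_tree (learned (1 - mu) s) (nseq n 0).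

Definition learner_success mu s := outputs p (learning_input mu s)
  [set h | halfspaces_of_mass D mu h /\
     error D h c <= inf [set error D g c | g in halfspaces_of_mass D mu] + e].

Hypothesis halts : forall (mu : R) s, 0 < mu < 1 -> halts_within p (learning_input mu s) beta.

Lemma run_learned mu s : 0 < mu < 1 ->
  runs_in p (learning_input mu s) (Num.trunc beta) (learned mu s).
Proof.
move=> /(halts s) [t [u [rt tbeta]]].
have le : (t <= Num.trunc beta)%N.
  by rewrite truncn_ge_nat // (le_trans _ tbeta).
by exists t => //; rewrite /learned (eval_run rt le).
Qed.

Lemma learner_successP mu s : 0 < mu < 1 -> learner_success mu s ->
  exists w t, [/\ learned mu s = of_halfspace w t, nonzero w,
    halfspaces_of_mass D mu (halfspace w t) &
    forall h', halfspaces_of_mass D mu h' -> gap D c h' - e / 2 <= gap D c (halfspace w t)].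
Proof.
move=> mu01 [t [w [theta [rt [mass opt]]]]].
have [t' rt' _] := run_learned s mu01.
exists w, theta; split => //.
(* Runs are deterministic: two runs on the same input agree with [eval] at a common cut-off. *)
- by rewrite -(eval_run rt' (leq_maxl t' t)) (eval_run rt (leq_maxr t' t)).
- by apply: (nonzero_mass (t := theta)); rewrite mass.2.
- by move=> h'; exact: gap_near_optimal.
Qed.

Lemma learned_candidateP mu s : 0 < mu < 1 ->
  learner_success mu s -> learner_success (1 - mu) s ->
  (forall side, exists w t, [/\ learned_candidate mu side s = of_halfspace w t, nonzero w &
     pr D [set x | halfspace w t x] = mu]) /\
  (forall h', halfspaces_of_mass D mu h' -> exists side,
     `|gap D c h'| - e / 2 <= `|gap D c (tree_halfspace (learned_candidate mu side s))|).
Proof.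
move=> mu01 succ succ'; have mu01' : 0 < 1 - mu < 1 by lra.
have [w [t [Ew w0 mass opt]]] := learner_successP mu01 succ.
have [w' [t' [Ew' w0' mass' opt']]] := learner_successP mu01' succ'.
have EN : complement_tree (learned (1 - mu) s) (nseq n 0) =
    of_halfspace [tuple of [seq - y | y <- w']] (- t').
  by rewrite Ew' complement_treeK // size_nseq.
split=> [[]|h' mass_h'] /=.
- by exists w, t; split => //; exact: mass.2.
- exists [tuple of [seq - y | y <- w']], (- t'); split => //; first exact: nonzeroN.
  by rewrite pr_halfspaceN // mass'.2; lra.
have [ge0|lt0] := lerP 0 (gap D c h').
  exists true; rewrite /= Ew tree_halfspaceK ger0_norm //.
  by apply: le_trans (opt _ mass_h') _; exact: ler_norm.
exists false; rewrite /= EN tree_halfspaceK gapN // normrN ltr0_norm //.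
(* The complement of [h'] competes at mass [1 - mu] with the opposite, positive gap. *)
case: mass_h' lt0 => -[v [r [v0 ->]]] massv lt0.
rewrite -gapN //; apply: le_trans (opt' _ _) (ler_norm _); split.
  by exists [tuple of [seq - y | y <- v]], (- r); split => //; exact: nonzeroN.
by rewrite pr_halfspaceN // massv.
Qed.

Lemma tree_measurable_learned mu : tree_measurable (learned mu).
Proof.
apply: tree_measurable_eval; do 4 (apply: tree_measurable_Cons;
  first by apply: tree_measurable_Num; exact: measurable_cst).
apply: tree_measurable_Cons; last exact: tree_measurable_Nil.
exact: tree_measurable_sample.
Qed.

Lemma tree_measurable_candidate mu side : tree_measurable (learned_candidate mu side).
Proof.
case: side; first exact: tree_measurable_learned.
by apply: tree_measurable_complement; exact: tree_measurable_learned.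
Qed.

Definition candidate_excess mu side s x :=
  excess c (tree_halfspace (learned_candidate mu side s)) mu x.

(** The exact mean of the test statistic for every training sample; it equals the gap when the
    candidate has mass [mu], that is, when the learner has succeeded. *)
Definition candidate_mean mu side s :=
  pr D ([set x | c x] `&` [set x | tree_halfspace (learned_candidate mu side s) x])
    - mu * pr D [set x | c x].

Lemma measurable_candidate_excess mu side :
  measurable_fun [set: m.-tuple (n.-tuple R) * n.-tuple R]
    (fun z => candidate_excess mu side z.1 z.2).
Proof.
apply: measurable_fun_ifT => //; first exact: (measurableT_comp mc measurable_snd).
apply: measurable_funB => //; apply: measurable_fun_ifT => //.
exact: (measurable_tree_halfspace (tree_measurable_candidate mu side)).
Qed.

(** The lower deviation is the upper deviation of the negated statistic. *)
Definition deviates mu side : set ((T + m).-tuple (n.-tuple R)) :=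
  upper_deviation (candidate_excess mu side) (candidate_mean mu side) e `|`
  upper_deviation (fun s x => - candidate_excess mu side s x)
    (fun s => - candidate_mean mu side s) e.

Lemma deviatesN mu side s : ~ deviates mu side s ->
  `|\sum_(x <- take T s) candidate_excess mu side (tuple_drop s) x
     - T%:R * candidate_mean mu side (tuple_drop s)| <= T%:R * e.
Proof.
move=> /not_orP[/negP up /negP down].
rewrite -ltNge in up; rewrite sumrN -ltNge in down.
by rewrite ler_norml; move: up down; clear; lra.
Qed.

Lemma deviates_le mu side : 0 < mu < 1 -> 0 < e <= 1 ->
  (1 + e * e / 32) ^- T <= dl ->
  measurable (deviates mu side) /\
  (iid D (T + m) (deviates mu side) <= (dl + dl)%:E)%E.
Proof.
move=> mu01 e01 small.
have mu01' : 0 <= mu <= 1 by lra.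
have mX := measurable_candidate_excess mu side.
have X1 s x : `|candidate_excess mu side s x| <= 1 by exact: excess_le1.
have Xg s : (\int[D]_x (candidate_excess mu side s x)%:E =
    (candidate_mean mu side s)%:E)%E.
  by apply: integral_excess => //; exact: measurable_halfspace.
have mXN : measurable_fun [set: m.-tuple (n.-tuple R) * n.-tuple R]
    (fun z => - candidate_excess mu side z.1 z.2).
  exact: measurable_funN.
have XN1 s x : `|- candidate_excess mu side s x| <= 1 by rewrite normrN.
have XNg s : (\int[D]_x (- candidate_excess mu side s x)%:E =
    (- candidate_mean mu side s)%:E)%E.
  have mXs : measurable_fun [set: n.-tuple R] (candidate_excess mu side s).
    exact: (measurableT_comp mX (measurable_pair1 s)).
  have := integral_affine 0 (-1) mXs (X1 s) (Xg s).
  rewrite add0r mulN1r => <-; apply: eq_integral => x _.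
  by rewrite add0r mulN1r.
have m1 := measurable_upper_deviation (k := T) mX X1 Xg e01.
have m2 := measurable_upper_deviation (k := T) mXN XN1 XNg e01.
split; first exact: measurableU.
by apply: measure_setU_le => //; (apply: le_trans (upper_deviation_le _ _ _ _ _) _ => //;
  rewrite lee_fin exprVn).
Qed.

Definition audit_input a b eps delta (s : (T + m).-tuple (n.-tuple R)) : tree R :=
  of_seq [:: Num n%:R; Num a; Num b; Num eps; Num delta; labeled_sample s c].

Definition empirical mu side (s : (T + m).-tuple (n.-tuple R)) : R :=
  \sum_(x <- take T s) candidate_excess mu side (tuple_drop s) x.

Definition audit_time (K : nat) : nat :=
  K * (2 * Num.trunc beta + 120 * n + 2 * (T * (50 * n + 200)) + 1000) + 300 * T + 1000.

(** * The guarantee of the auditor *)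

Section Masses.
Variables (a b eps delta : R) (K : nat).
Hypotheses (a0 : 0 < a) (b1 : b < 1).
Hypotheses (eps01 : 0 < eps < 1) (delta01 : 0 < delta < 1).
Hypotheses (eE : e = eps / 4) (dlE : dl = delta * e / 12).
Hypotheses (T0 : (0 < T)%N) (K0 : (0 < K)%N).
Hypothesis T_small : forall j, (j < T)%N -> (1 + e * e / 32) ^+ j * dl <= 1.
Hypothesis T_large : 1 < (1 + e * e / 32) ^+ T * dl.
Hypothesis K_small : forall j, (j < K)%N -> a + j%:R * e <= b.
Hypothesis K_large : b < a + K%:R * e.

Let mass j : R := a + j%:R * e.

Let e01 : 0 < e < 1.
Proof. by rewrite eE; have := eps01; lra. Qed.

Let mass01 j : (j < K)%N -> 0 < mass j < 1.
Proof.
move=> /K_small; have : 0 <= j%:R * e by rewrite mulr_ge0 //; case/andP: e01 => /ltW.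
by rewrite /mass; have := a0; have := b1; lra.
Qed.

Lemma run_audit s : exists j side, [/\ (j < K)%N,
  forall j' side', (j' < K)%N ->
    `|empirical (mass j') side' s| <= `|empirical (mass j) side s| &
  runs_in (paudit p) (audit_input a b eps delta s) (audit_time K)
    (learned_candidate (mass j) side (tuple_drop s))].
Proof.
pose smp := [seq (tval x, c x) | x : n.-tuple R <- s].
have trainE : of_seq (map (@example R) (drop T smp)) = labeled_sample (tuple_drop s) c.
  by rewrite labeled_sampleE val_tuple_drop /smp -map_drop.
have testE : rev (take T smp) = rev [seq (tval x, c x) | x : n.-tuple R <- take T s].
  by rewrite /smp -map_take.
have szsmp : size smp = (T + m)%N by rewrite size_map size_tuple.
have run_p mu : 0 < mu < 1 -> runs_in p (of_seq [:: Num n%:R; Num mu; Num (eps / 4);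
    Num (delta * (eps / 4) / 12); of_seq (map (@example R) (drop T smp))])
    (Num.trunc beta) (learned mu (tuple_drop s)).
  by rewrite trainE -eE -dlE; exact: run_learned.
have allsmp : all (fun xb => size xb.1 == n) smp.
  by apply/allP => _ /mapP[x _ ->] /=; rewrite size_tuple.
have leT : (0 < T <= size smp)%N by rewrite T0 szsmp leq_addr.
have eps0 : 0 < eps by case/andP: eps01.
have Ts := T_small; have Tl := T_large; have Ks := K_small; have Kl := K_large.
rewrite eE in Ts Tl Ks Kl; rewrite dlE eE in Ts Tl.
have [j [side [ltj maxj ra]]] := runs_paudit a0 b1 eps0 run_p allsmp leT Ts Tl K0 Ks Kl.
(* The first test point is replaced as clock by [nseq n 0]. *)
have candE mu sd : candidate (rev (take T smp)) (learned^~ (tuple_drop s)) mu sd =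
    learned_candidate mu sd (tuple_drop s).
  case: sd => //; apply: complement_tree_size; rewrite size_nseq.
  have : all (fun xb => size xb.1 == n) (rev (take T smp)).
    by rewrite all_rev; apply/allP => x /mem_take; exact: (allP allsmp).
  have : (0 < size (rev (take T smp)))%N by rewrite size_rev size_takel //; case/andP: leT.
  by case: (rev _) => // xb ts _ /= /andP[/eqP].
have scoreE mu sd : candidate_score (rev (take T smp)) (learned^~ (tuple_drop s)) mu sd =
    `|empirical mu sd s|.
  by rewrite /candidate_score candE testE score_excess.
rewrite -eE in maxj ra; exists j, side; split => //.
- by move=> j' side' ltj'; have := maxj j' side' ltj'; rewrite !scoreE.
- by rewrite candE in ra; rewrite /audit_input labeled_sampleE.
Qed.

Lemma audit_halts s :
  halts_within (paudit p) (audit_input a b eps delta s) (audit_time K)%:R.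
Proof.
have [j [side [_ _ [t rt le]]]] := run_audit s.
by exists t, (learned_candidate (mass j) side (tuple_drop s)); rewrite ler_nat.
Qed.

Definition misled j : set ((T + m).-tuple (n.-tuple R)) :=
  [set s | ~ (learner_success (mass j) (tuple_drop s) /\
              learner_success (1 - mass j) (tuple_drop s) /\
              forall side, ~ deviates (mass j) side s)].

(** Against a significant competitor less than [e] is lost by shrinking its mass to the grid,
    [e / 2] by the learner and [2 * e] by selecting on empirical scores; the sum is below
    [4 * e = eps]. *)
Lemma audit_outputs s : (forall j, (j < K)%N -> ~ misled j s) ->
  outputs (paudit p) (audit_input a b eps delta s)
    [set h | significant D a b h /\
      sup [set unfairness D c g | g in significant D a b] - eps <= unfairness D c h].
Proof.
move=> good; have {}good j : (j < K)%N -> learner_success (mass j) (tuple_drop s) /\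
    learner_success (1 - mass j) (tuple_drop s) /\ forall side, ~ deviates (mass j) side s.
  by move=> /good /contrapT.
have [j [side [ltj maxj [t rt _]]]] := run_audit s.
have e0 : 0 < e by case/andP: e01.
have massE i sd : (i < K)%N ->
    candidate_mean (mass i) sd (tuple_drop s) =
    gap D c (tree_halfspace (learned_candidate (mass i) sd (tuple_drop s))).
  move=> lti; have [succ [succ' _]] := good i lti.
  have [/(_ sd)[w [r [E _ mr]]] _] := learned_candidateP (mass01 lti) succ succ'.
  by rewrite /candidate_mean /gap E tree_halfspaceK mr mulrC.
have close i sd : (i < K)%N -> `|empirical (mass i) sd s - T%:R *
    gap D c (tree_halfspace (learned_candidate (mass i) sd (tuple_drop s)))| <= T%:R * e.
  move=> lti; have [_ [_ /(_ sd) dev]] := good i lti.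
  by rewrite -massE //; exact: deviatesN.
pose out : n.-tuple R -> bool := tree_halfspace (learned_candidate (mass j) side (tuple_drop s)).
have best i sd : (i < K)%N ->
    `|gap D c (tree_halfspace (learned_candidate (mass i) sd (tuple_drop s)))| - 2 * e
      <= `|gap D c out|.
  move=> lti; have T0R : 0 < T%:R :> R by rewrite ltr0n.
  exact: compare_estimates T0R (close i sd lti) (close j side ltj) (maxj i sd lti).
have [succ [succ' _]] := good j ltj.
have [/(_ side)[w [theta [Ew w0 mw]]] _] := learned_candidateP (mass01 ltj) succ succ'.
rewrite Ew in rt; exists t, w, theta; split => //.
have outE : out = halfspace w theta by rewrite /out Ew tree_halfspaceK.
have aj : a <= mass j <= b.
  by rewrite K_small // lerDl mulr_ge0 // ltW.
have sig : significant D a b (halfspace w theta).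
  by split; [exists w, theta | rewrite mw].
split => //.
have sig_unfair g : significant D a b g -> unfairness D c g = `|gap D c g|.
  by case=> _ /andP[ag _]; rewrite unfairnessE // (lt_le_trans a0).
rewrite lerBlDr; apply: ge_sup.
  (* The output itself shows that the set under the supremum is nonempty. *)
  by exists (unfairness D c (halfspace w theta)), (halfspace w theta).
move=> _ [g sigg <-]; rewrite !sig_unfair // -outE.
case: sigg => -[v [r [v0 ->]]] /andP[ag gb].
(* The largest grid mass that does not exceed the competitor's. *)
pose i := Num.trunc ((pr D [set x | halfspace v r x] - a) / e).
have le_i : mass i <= pr D [set x | halfspace v r x].
  rewrite /mass -lerBrDl -ler_pdivlMr // truncn_le divr_ge0 ?subr_ge0 //.
  exact: ltW.
have lt_i : pr D [set x | halfspace v r x] < mass i + e.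
  have := truncnS_gt ((pr D [set x | halfspace v r x] - a) / e).
  by rewrite ltr_pdivrMr // -natr1 mulrDl mul1r -/i /mass; lra.
have ltiK : (i < K)%N.
  have : a + i%:R * e < a + K%:R * e.
    by apply: le_lt_trans K_large; exact: le_trans gb.
  by rewrite ltrD2l ltr_pM2r // ltr_nat.
have [|r' rr' mass_r'] := halfspace_shrink contD v0 (t := r) (nu := mass i).
  by rewrite le_i andbT; case/andP: (mass01 ltiK).
have [succi [succi' _]] := good i ltiK.
have [_ opt] := learned_candidateP (mass01 ltiK) succi succi'.
have [|sd opt_sd] := opt (halfspace v r').
  by split => //; exists v, r'.
have sub : `|gap D c (halfspace v r) - gap D c (halfspace v r')| <=
    pr D [set x | halfspace v r x] - mass i.
  rewrite -mass_r'; apply: gap_subset => //; try exact: measurable_halfspace.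
  by move=> x; rewrite /halfspace !subr_ge0; exact: le_trans.
have tri := lerB_dist (gap D c (halfspace v r)) (gap D c (halfspace v r')).
have best_i := best i sd ltiK.
have epsE : eps = 4 * e by rewrite eE; lra.
by move: opt_sd sub tri best_i lt_i e0; rewrite epsE; lra.
Qed.

Hypothesis learner_prob : forall mu : R, 0 < mu < 1 ->
  prob_at_least (iid D m) (learner_success mu) (1 - dl).
Hypothesis K_le : K%:R <= 1 + e^-1.

(** The learner's guarantee concerns [m] draws; it is pulled back to the full sample along
    [tuple_drop], which preserves the law. *)
Let learner_failure mu : 0 < mu < 1 -> exists A : set ((T + m).-tuple (n.-tuple R)),
  [/\ measurable A, (iid D (T + m) A <= dl%:E)%E &
    forall s, ~ A s -> learner_success mu (tuple_drop s)].
Proof.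
move=> /learner_prob [F [mF Fsub leF]].
have mFC : measurable (~` F) by exact: measurableC.
exists (@tuple_drop _ (n.-tuple R) m T @^-1` (~` F)); split.
- by rewrite -[X in measurable X]setTI; exact: measurable_tuple_drop.
- rewrite iid_tuple_drop // probability_setC //.
  have fF : iid D m F \is a fin_num by exact: fin_num_measure.
  move: leF; rewrite -(fineK fF) -EFinB !lee_fin; lra.
- by move=> s /contrapT /Fsub.
Qed.

(** Success of the learner need not be a measurable event, hence the measurable superset [A]. Six
    events of probability at most [dl] enter it: failure at the two masses, and an upper and a lower
    deviation for each of the two candidates. *)
Lemma misled_le j : (j < K)%N -> exists A : set ((T + m).-tuple (n.-tuple R)),
  [/\ measurable A, (iid D (T + m) A <= (6 * dl)%:E)%E & misled j `<=` A].
Proof.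
move=> ltjK; have mu01 := mass01 ltjK.
have mu01' : 0 < 1 - mass j < 1 by lra.
have [A1 [mA1 leA1 A1P]] := learner_failure mu01.
have [A2 [mA2 leA2 A2P]] := learner_failure mu01'.
have e01' : 0 < e <= 1 by case/andP: e01 => -> /ltW.
have dl_ge : (1 + e * e / 32) ^- T <= dl.
  have pos : 0 < 1 + e * e / 32.
    by case/andP: e01 => e0 _; rewrite addr_gt0 // divr_gt0 // mulr_gt0.
  by rewrite -[leLHS]mul1r ler_pdivrMr ?exprn_gt0 // mulrC ltW.
have [mA3 leA3] := deviates_le true mu01 e01' dl_ge.
have [mA4 leA4] := deviates_le false mu01 e01' dl_ge.
exists ((A1 `|` A2) `|` (deviates (mass j) true `|` deviates (mass j) false)); split.
- by apply: measurableU; exact: measurableU.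
- rewrite (_ : 6 * dl = (dl + dl) + ((dl + dl) + (dl + dl))); last by ring.
  apply: measure_setU_le; [exact: measurableU | exact: measurableU | |];
    exact: measure_setU_le.
- move=> s; apply: contra_notP => /not_orP[/not_orP[nA1 nA2] /not_orP[nA3 nA4]].
  by split; [exact: A1P | split; [exact: A2P | case]].
Qed.

Lemma audit_prob : prob_at_least (iid D (T + m))
  [set s | outputs (paudit p) (audit_input a b eps delta s)
    [set h | significant D a b h /\
      sup [set unfairness D c g | g in significant D a b] - eps <= unfairness D c h]]
  (1 - delta).
Proof.
have /choice[A AP] : forall j, exists A : set ((T + m).-tuple (n.-tuple R)),
    (j < K)%N -> [/\ measurable A, (iid D (T + m) A <= (6 * dl)%:E)%E & misled j `<=` A].
  move=> j; have [/misled_le[A AP]|geK] := ltnP j K; first by exists A.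
  by exists set0.
have [j ltj|j ltj|F [mF leF disj]] :=
  union_bound (P := iid D (T + m)) (B := A) (r := 6 * dl) (N := K).
- by have [] := AP j ltj.
- by have [] := AP j ltj.
exists F; split => //.
  move=> s Fs; apply: audit_outputs => j ltj mis.
  by have [_ _ /(_ s mis)] := AP j ltj; exact: disj ltj Fs.
apply: le_trans leF; rewrite lee_fin lerD2l lerN2.
have [e0 e1] := andP e01; have [d0 _] := andP delta01.
have dl0 : 0 <= 6 * dl by rewrite mulr_ge0 // dlE divr_ge0 // mulr_ge0 // ltW.
(* Origin of the 12 in [dl]: at most 2/e masses with failure probability 6 dl each give 12 dl / e =
   delta. *)
have Kle : K%:R <= 2 * e^-1.
  have : 1 <= e^-1 by rewrite invf_ge1 // ltW.
  by have := K_le; lra.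
apply: le_trans (ler_wpM2r dl0 Kle) _.
by rewrite dlE [leLHS](_ : _ = delta) //; field; exact: lt0r_neq0.
Qed.

End Masses.
End Run.
End Audit.

Theorem theorem3p1 (R : realType) (B : primitives R) (I : Type) (n : I -> nat)
    (D : forall i, probability ((n i).-tuple R) R)
    (c : forall i, (n i).-tuple R -> bool)
    (mc : forall i, measurable_fun [set: (n i).-tuple R] (c i))
    (contD : forall i, continuous_marginals (D i)) :
  (exists p : prog B, efficient_agnostic_learner D p) ->
  exists q : prog B, efficient_auditor D c q.
Proof.
move=> [p [C [k learner]]].
have [C' budget_le] := auditor_budget R C k.
exists (paudit p), C', (k + 5)%N => i a b eps delta M a0 ab b1 eps01 delta01 M_large.
pose e := eps / 4; pose dl := delta * e / 12.
have [eps0 eps1] := andP eps01; have [d0 d1] := andP delta01.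
have e0 : 0 < e by rewrite divr_gt0.
have e1 : e < 1 by rewrite /e; move: eps1; clear; lra.
have dl0 : 0 < dl by rewrite divr_gt0 // mulr_gt0.
have dl1 : dl < 1.
  have : delta * e <= 1 * 1 by rewrite ler_pM // ltW.
  by rewrite /dl ltr_pdivrMr // mul1r; clear; lra.
have x01 : 0 < e * e / 32 <= 1.
  rewrite divr_gt0 ?mulr_gt0 //=.
  have : e * e <= 1 * 1 by rewrite ler_pM // ltW.
  by clear; lra.
have [|T [T0 T_small T_large T_le]] := sample_count x01 (dl := dl); first by rewrite dl0.
have [K [K0 K_small K_large K_le]] := grid_count a0 ab b1 e0.
set beta := budget C k (n i) e dl in budget_le *.
have beta0 : 0 <= beta.
  have ie0 : 0 <= e^-1 by rewrite invr_ge0 ltW.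
  have ln0 : 0 <= ln dl^-1 by rewrite ln_ge0 // invf_ge1 // ltW.
  by rewrite /beta /budget mulr_ge0 // exprn_ge0 // !addr_ge0.
have tau_le : (Num.trunc beta)%:R <= budget C k (n i) e dl by rewrite truncn_le.
have [time_le T_beta] := budget_le (n i) _ T K eps delta eps01 delta01 tau_le T_le K_le.
(* The [m] examples that remain after the [T] test examples still meet the learner's demand. *)
have [m Em] : exists m, M = (T + m)%N.
  have leTM : (T <= M)%N.
    rewrite -(ler_nat R) (le_trans _ (le_trans T_beta M_large)) // lerDl //.
  by exists (M - T)%N; rewrite subnKC.
have m_large : budget C k (n i) e dl <= m%:R.
  have := le_trans T_beta M_large.
  by rewrite Em natrD lerD2l.
subst M.
have e01 : 0 < e < 1 by rewrite e0.
have dl01 : 0 < dl < 1 by rewrite dl0.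
(* The labeling to be learned is the audited classifier itself. *)
have learn mu (mu01 : 0 < mu < 1) :=
  learner i mu e dl (c i) m mu01 e01 dl01 (mc i) m_large.
have halts (mu : R) (s : m.-tuple ((n i).-tuple R)) :
    0 < mu < 1 -> halts_within p (learning_input (c i) e dl mu s) beta.
  by move=> mu01; have [h _] := learn mu mu01; exact: h.
split=> [s|].
  have [t [u [rt let_]]] := audit_halts halts a0 b1 eps01 (erefl : e = eps / 4)
    (erefl : dl = delta * e / 12) T0 K0 T_small T_large K_small K_large s.
  by exists t, u; split => //; exact: le_trans let_ time_le.
apply: (audit_prob (mc i) (contD i) halts a0 b1 eps01 delta01
    (erefl : e = eps / 4) (erefl : dl = delta * e / 12) T0 K0 T_small T_large
    K_small K_large _ K_le) => mu mu01.
by have [_ h] := learn mu mu01; exact: h.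
Qed.
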